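(* Let $(\mathcal{T},d)$ be a compact metric space and let $\delta>0$ be a real number. Then there exists a countable set $\mathcal{J}$ of pairs $\{x,y\}$ of non-equal points of $\mathcal{T}$ such that the direct sum $ST(\delta)=(C(\mathcal{T}),H,D)$ of the two-point spectral triples $ST_{x,y}$ over $\{x,y\}\in\mathcal{J}$ has the following properties: (1) $ST(\delta)$ is a spectral triple for $C(\mathcal{T})$, and the metric $d_\delta$ it induces on $\mathcal{T}$ satisfies $$\forall s,t\in\mathcal{T}:\quad d(s,t)\le d_\delta(s,t)\le(1+\delta)\,d(s,t).$$ (2) If the upper Minkowski dimension $\overline{\dim}_M(\mathcal{T})$ is finite, then $ST(\delta)$ is summable for every real $s>2\,\overline{\dim}_M(\mathcal{T})$, i.e. $\mathrm{tr}\big((I+D^2)^{-s/2}\big)<\infty$ for every such $s$. (3) If $ST(\delta)$ is summable for some $s>0$, i.e. $\mathrm{tr}\big((I+D^2)^{-s/2}\big)<\infty$, and the topological space $\mathcal{T}$ is connected, then $\overline{\dim}_M(\mathcal{T})\le s$.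
   Context: $C(\mathcal{T})$ is the C*-algebra of continuous complex functions on the (nonempty) compact metric space $\mathcal{T}$. Spectral triple: let $\mathcal{A}$ be a unital C*-algebra, $H$ a Hilbert space carrying a unital representation $\pi$ of $\mathcal{A}$, and $D$ a (generally unbounded) self-adjoint operator on $H$. The set $(\mathcal{A},H,D)$ is a spectral triple if (i) $\{a\in\mathcal{A} : \|[D,\pi(a)]\|<\infty\}$ is a dense subset of $\mathcal{A}$, and (ii) $(I+D^2)^{-1}$ is compact. It is $p$-summable (summable for $p$), $p>0$, if $\mathrm{tr}((I+D^2)^{-p/2})<\infty$. The zero Hilbert space is allowed, and a countable set may be finite or empty. Two-point triple: for $x\ne y$ in $\mathcal{T}$, $ST_{x,y}=(C(\mathcal{T}),H_{x,y},D_{x,y})$ with $H_{x,y}=\mathbb{C}^2$, representation $\pi_{x,y}(f)(\alpha,\beta)=(f(x)\alpha,f(y)\beta)$, and $D_{x,y}(\alpha,\beta)=\left(\frac{\beta}{d(x,y)},\frac{\alpha}{d(x,y)}\right)$. Direct sum: the direct sum of $ST_{x,y}$ over $\{x,y\}\in\mathcal{J}$ is $(C(\mathcal{T}),H,D)$, where $H$ is the Hilbert space direct sum of the $H_{x,y}$, $\pi=\bigoplus\pi_{x,y}$, and $D$ is the self-adjoint operator which is the closure of the algebraic direct sum of the $D_{x,y}$. The commutator $[D,\pi(f)]$ is defined on the algebraic direct sum of the $H_{x,y}$, and $\|[D,\pi(f)]\|=\sup_{\{x,y\}\in\mathcal{J}}\|[D_{x,y},\pi_{x,y}(f)]\|\in[0,\infty]$.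 Induced metric: for a spectral triple $ST=(\mathcal{A},H,D)$ and states $\phi,\psi$ of $\mathcal{A}$, $d_{ST}(\phi,\psi)=\sup\{|\phi(a)-\psi(a)| : a\in\mathcal{A},\ \|[D,\pi(a)]\|\le1\}\in[0,\infty]$. For $\mathcal{A}=C(\mathcal{T})$ a point $t\in\mathcal{T}$ is identified with the state $f\mapsto f(t)$, so the metric induced by $ST(\delta)$ on $\mathcal{T}$ is $d_\delta(s,t)=\sup\{|f(s)-f(t)| : f\in C(\mathcal{T}),\ \|[D,\pi(f)]\|\le1\}$. Upper Minkowski (upper box counting) dimension: for $r>0$ let $N_r$ be the minimal number of closed balls of radius $r$, centered at points of $\mathcal{T}$, needed to cover $\mathcal{T}$; then $$\overline{\dim}_M(\mathcal{T})=\limsup_{r\to0}\frac{\log(N_r)}{-\log(r)}\in[0,\infty].$$ *)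

(* Defs.v *)
From HB Require Import structures.
From mathcomp Require Import all_boot all_order all_algebra.
From mathcomp Require Import all_classical all_reals all_analysis.
From mathcomp Require Import complex ring lra.
Set Implicit Arguments.
Unset Strict Implicit.
Unset Printing Implicit Defensive.
Import Order.TTheory GRing.Theory Num.Theory numFieldNormedType.Exports.
Local Open Scope classical_set_scope.
Local Open Scope ring_scope.

HB.mixin Record isHilbert (R : realType) H & CompleteNormedModule R[i] H := {
  hdot : {dot H for Num.Def.conjC} ;
  hdotxx : forall x : H, hdot x x = `|x| ^+ 2 }.

#[short(type="hilbertType")]
HB.structure Definition Hilbert (R : realType) :=
  {H of CompleteNormedModule R[i] H & isHilbert R H}.

(* Norms of complex normed modules take values in R[i]; [rnorm] is the same
   number as an element of R. *)
Definition rnorm (R : realType) (V : normedModType R[i]) (x : V) : R :=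
  complex.Re `|x|.

Section rnorm.
Variables (R : realType) (V : normedModType R[i]).
Implicit Types x y : V.

Lemma rnormE x : `|x| = (rnorm x)%:C%C.
Proof. by rewrite /rnorm RRe_real// normr_real. Qed.

Lemma rnorm_ge0 x : 0 <= rnorm x.
Proof. by rewrite -lecR -rnormE; exact: normr_ge0. Qed.

Lemma rnorm0 : rnorm (0 : V) = 0.
Proof. by rewrite /rnorm normr0. Qed.

Lemma rnorm0_eq0 x : rnorm x = 0 -> x = 0.
Proof. by move=> x0; apply: normr0_eq0; rewrite rnormE x0. Qed.

Lemma rnormD x y : rnorm (x + y) <= rnorm x + rnorm y.
Proof. by rewrite -lecR rmorphD/= -!rnormE ler_normD. Qed.

Lemma rnormZ (k : R[i]) x : rnorm (k *: x) = complex.Re `|k| * rnorm x.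
Proof.
by rewrite /rnorm normrZ [in LHS]rnormE [`|k|]normc_def/=; simpc.
Qed.

Lemma rnormN x : rnorm (- x) = rnorm x.
Proof. by rewrite /rnorm normrN. Qed.

Lemma rnormB x y : rnorm (x - y) = rnorm (y - x).
Proof. by rewrite /rnorm distrC. Qed.

End rnorm.

(* An alias of R[i]^o: the completeness instance of the library for the regular
   module covers only real types. *)
Definition complex_line (R : realType) : Type := R[i]^o.

Section complex_hilbert.
Variable R : realType.
Local Notation C := (complex_line R).

HB.instance Definition _ := NormedModule.copy C R[i]^o.

Lemma conjCE (z : R[i]) : Num.conj z = (z^*)%C.
Proof. by []. Qed.

Let ger0_complex (e : R[i]) : 0 < e -> exists2 r : R, 0 < r & e = r%:C%C.
Proof.
move=> e0; have eE : e = (complex.Re e)%:C%C by rewrite RRe_real// gtr0_real.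
by exists (complex.Re e) => //; rewrite -ltcR -eE.
Qed.

Let normC_Re (z : R[i]) (r : R) : `|z| < r%:C%C -> `|complex.Re z| < r.
Proof. by rewrite -ltcR; apply: le_lt_trans; exact: normc_ge_Re. Qed.

Let normC_Im (z : R[i]) (r : R) : `|z| < r%:C%C -> `|complex.Im z| < r.
Proof.
move=> zr; have : `|(complex.Im z)%:C%C| <= `|z|.
  rewrite [in leRHS]normc_def normc_def/= lecR ler_sqrt ?addr_ge0 ?sqr_ge0//.
  by rewrite expr0n addr0 lerDr sqr_ge0.
rewrite normc_def/= expr0n addr0 sqrtr_sqr => h.
by rewrite -ltcR; exact: le_lt_trans zr.
Qed.

Let complex_cauchy_cvg (F : set_system C) : ProperFilter F -> cauchy F -> cvg F.
Proof.
move=> FF /cauchy_ballP cF.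
have cp (p : C -> R) : (forall x y, p (x - y) = p x - p y) ->
    (forall z r, `|z| < r%:C%C -> `|p z| < r) -> cvg (p @ F).
  move=> pB plt; apply: R_complete; apply/cauchy_ballP => e e0.
  have : 0 < e%:C%C :> R[i] by rewrite ltcR.
  move/cF => [[A B]/= [FA FB] AB].
  exists (p @` A, p @` B) => /=.
    split; rewrite /nbhs/=.
      by apply: filterS FA => z Az; exists z.
    by apply: filterS FB => z Bz; exists z.
  move=> [_ _] /= [[x Ax <-] [y By <-]].
  have := AB (x, y) (conj Ax By); rewrite /ball/= => /plt.
  by rewrite pB.
have ReB (x y : C) : complex.Re (x - y) = complex.Re x - complex.Re y.
  by case: x y => [? ?] [? ?].
have ImB (x y : C) : complex.Im (x - y) = complex.Im x - complex.Im y.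
  by case: x y => [? ?] [? ?].
have /cvg_ex[a /cvgrPdist_lt ca] := cp _ ReB normC_Re.
have /cvg_ex[b /cvgrPdist_lt cb] := cp _ ImB normC_Im.
have normCi : `|'i%C : R[i]| = 1.
  by rewrite normc_def/= expr0n add0r expr1n sqrtr1.
apply/cvg_ex; exists (Complex a b : C).
apply/cvgrPdist_lt => _ /ger0_complex[r r0 ->].
have r20 : 0 < r / 2 by rewrite divr_gt0.
near=> z.
have -> : (Complex a b : C) - z =
    (a - complex.Re z)%:C%C + 'i%C * (b - complex.Im z)%:C%C.
  by case: (z) => x y /=; simpc.
rewrite (le_lt_trans (ler_normD _ _))// normrM normCi mul1r.
rewrite !normc_def/= !expr0n !addr0 !sqrtr_sqr -rmorphD/= ltcR.
rewrite [ltRHS]splitr ltrD//.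
  by near: z; exact: ca.
by near: z; exact: cb.
Unshelve. all: by end_near. Qed.

HB.instance Definition _ := Uniform_isComplete.Build C complex_cauchy_cvg.

Definition cdot (x y : C) : R[i] := (x : R[i]) * Num.conj (y : R[i]).

Let cdot_bilinear :
  bilinear_for *%R (Num.Def.conjC \; *%R) cdot.
Proof.
split=> [y a u v|y a u v] /=; rewrite /cdot.
  by rewrite mulrDl -mulrA.
by rewrite rmorphD rmorphM mulrDr mulrCA.
Qed.

HB.instance Definition _ := bilinear_isBilinear.Build R[i] C C R[i]
  *%R (Num.Def.conjC \; *%R) cdot cdot_bilinear.

Let cdot_herm (x y : C) : cdot x y = (-1) ^+ false * Num.conj (cdot y x).
Proof. by rewrite expr0 mul1r /cdot rmorphM /= conjCK mulrC. Qed.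

HB.instance Definition _ := isHermitianSesquilinear.Build R[i] C
  false Num.Def.conjC cdot cdot_herm.

Let cdot_gt0 (x : C) : x != 0 -> 0 < cdot x x.
Proof. by move=> x0; rewrite /cdot mul_conjC_gt0. Qed.

HB.instance Definition _ := isDotProduct.Build R[i] C cdot cdot_gt0.

Let cdotxx (x : C) : cdot x x = `|x| ^+ 2.
Proof. by rewrite normCK. Qed.

HB.instance Definition _ := isHilbert.Build R C cdotxx.

End complex_hilbert.

Section real_sums.
Variables (R : realType) (I : choiceType).
Implicit Types f g : I -> R.

Definition esumr f : \bar R := (\esum_(i in [set: I]) (f i)%:E)%E.

Lemma esumr_ge f (A : set I) : finite_set A ->
  ((\sum_(i \in A) f i)%:E <= esumr f)%E.
Proof.
move=> fA; rewrite /esumr -fsumEFin//; apply: ereal_sup_ubound => /=.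
by exists A.
Qed.

Lemma esumr_le f M :
  (forall A, finite_set A -> \sum_(i \in A) f i <= M) -> (esumr f <= M%:E)%E.
Proof.
move=> fM; apply: ub_ereal_sup => _ /= [A [fA _] <-].
by rewrite fsumEFin// lee_fin fM.
Qed.

End real_sums.

Section sums.
Variables (R : realType) (I : choiceType).
Implicit Types (f g : I -> R) (z : I -> R[i]).

Lemma esumr_ge0 f : (forall i, 0 <= f i) -> (0 <= esumr f)%E.
Proof. by move=> f0; apply: esum_ge0 => i _; rewrite lee_fin. Qed.

Lemma esumrD f g : (forall i, 0 <= f i) -> (forall i, 0 <= g i) ->
  esumr (fun i => f i + g i) = (esumr f + esumr g)%E.
Proof. by move=> f0 g0; rewrite -esumD// => i _; rewrite lee_fin. Qed.

Lemma esumrZ f a : (forall i, 0 <= f i) -> 0 <= a ->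
  esumr (fun i => a * f i) = (a%:E * esumr f)%E.
Proof.
move=> f0 a0; rewrite /esumr /esum -ereal_supZl//; last first.
  by apply/set0P; exists 0%E => /=; exists set0; [split|rewrite fsbig_set0].
congr ereal_sup; rewrite image_comp; apply: eq_imagel => A [fA _] /=.
by rewrite !fsumEFin// -EFinM fsbig_distrr.
Qed.

Lemma le_esumr f g : (forall i, f i <= g i) -> (esumr f <= esumr g)%E.
Proof. by move=> fg; apply: le_esum => i _; rewrite lee_fin. Qed.

(* The sum of an absolutely summable family (a junk value otherwise). *)
Definition sumr f : R :=
  fine (esumr (fun i => Num.max (f i) 0)) -
  fine (esumr (fun i => Num.max (- f i) 0)).

Definition abs_summable f := (esumr (fun i => `|f i|%R) < +oo)%E.

Lemma sumrB f g : (forall i, 0 <= f i) -> (forall i, 0 <= g i) ->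
  (esumr f < +oo)%E -> (esumr g < +oo)%E ->
  sumr (fun i => f i - g i) = fine (esumr f) - fine (esumr g).
Proof.
move=> f0 g0 fy gy; rewrite /sumr.
set p := fun i => _; set q := fun i => _.
have p0 i : 0 <= p i by rewrite le_max lexx orbT.
have q0 i : 0 <= q i by rewrite le_max lexx orbT.
have py : (esumr p < +oo)%E.
  by apply: le_lt_trans fy; apply: le_esumr => i; rewrite ge_max f0 gerBl g0.
have qy : (esumr q < +oo)%E.
  apply: le_lt_trans gy; apply: le_esumr => i.
  by rewrite ge_max g0 opprB gerBl f0.
apply/eqP; rewrite subr_eq addrAC eq_sym subr_eq eq_sym; apply/eqP.
rewrite -!fineD ?ge0_fin_numE ?esumr_ge0// -!esumrD//; congr (fine (esumr _)).
apply/funext => i; rewrite /p /q.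
by case: (leP (f i - g i) 0) => h1; case: (leP (- (f i - g i)) 0) => h2; lra.
Qed.

Lemma sumr_ge0E f : (forall i, 0 <= f i) -> sumr f = fine (esumr f).
Proof.
move=> f0; rewrite /sumr (_ : (fun i => Num.max (- f i) 0) = (fun=> 0)).
  rewrite [X in _ - fine X]esum1// subr0; congr (fine (esumr _)).
  by apply/funext => i; apply/max_idPl.
by apply/funext => i; apply/max_idPr; rewrite oppr_le0.
Qed.

Lemma abs_summable_pos f : abs_summable f ->
  (esumr (fun i => Num.max (f i) 0)%R < +oo)%E.
Proof.
by apply: le_lt_trans; apply: le_esumr => i; rewrite ge_max normr_ge0 ler_norm.
Qed.

Lemma abs_summable_neg f : abs_summable f ->
  (esumr (fun i => Num.max (- f i) 0)%R < +oo)%E.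
Proof.
apply: le_lt_trans; apply: le_esumr => i.
by rewrite ge_max normr_ge0 -normrN ler_norm.
Qed.

Lemma abs_summableD f g : abs_summable f -> abs_summable g ->
  abs_summable (fun i => f i + g i).
Proof.
move=> fy gy; apply: (@le_lt_trans _ _ (esumr (fun i => `|f i| + `|g i|))).
  by apply: le_esumr => i; exact: ler_normD.
by rewrite esumrD// lte_add_pinfty.
Qed.

Lemma abs_summableZ f a : abs_summable f -> abs_summable (fun i => a * f i).
Proof.
move=> fy; rewrite /abs_summable.
under eq_fun do rewrite normrM.
rewrite esumrZ// lte_mul_pinfty// esumr_ge0//.
Qed.

Lemma sumrD f g : abs_summable f -> abs_summable g ->
  sumr (fun i => f i + g i) = sumr f + sumr g.
Proof.
move=> fy gy.
have m0 (h : I -> R) i : 0 <= Num.max (h i) 0 by rewrite le_max lexx orbT.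
have -> : (fun i => f i + g i) =
    (fun i => (Num.max (f i) 0 + Num.max (g i) 0) -
              (Num.max (- f i) 0 + Num.max (- g i) 0)).
  apply/funext => i.
  by case: (leP (f i) 0) => h1; case: (leP (- f i) 0) => h2;
     case: (leP (g i) 0) => h3; case: (leP (- g i) 0) => h4; lra.
rewrite sumrB//; last 4 first.
- by move=> i; rewrite addr_ge0.
- by move=> i; rewrite addr_ge0 ?(m0 (fun i => - f i)) ?(m0 (fun i => - g i)).
- by rewrite esumrD// lte_add_pinfty// abs_summable_pos.
- rewrite esumrD ?lte_add_pinfty ?abs_summable_neg//.
    exact: (m0 (fun i => - f i)).
  exact: (m0 (fun i => - g i)).
rewrite !esumrD ?fineD ?ge0_fin_numE ?esumr_ge0 ?abs_summable_neg ?abs_summable_pos//.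
all: try exact: (m0 (fun i => - f i)).
all: try exact: (m0 (fun i => - g i)).
by rewrite /sumr; lra.
Qed.

Lemma sumrN f : sumr (fun i => - f i) = - sumr f.
Proof. by rewrite /sumr opprB; under [in X in _ - X]eq_fun do rewrite opprK. Qed.

Lemma sumrZ f a : abs_summable f -> sumr (fun i => a * f i) = a * sumr f.
Proof.
have m0 (h : I -> R) i : 0 <= Num.max (h i) 0 by rewrite le_max lexx orbT.
wlog a0 : a / 0 <= a.
  move=> H fy; have [|a0] := leP 0 a; first by move/H; exact.
  have -> : (fun i => a * f i) = (fun i => - (- a * f i)).
    by apply/funext => i; rewrite mulNr opprK.
  by rewrite sumrN H// ?mulNr ?opprK// oppr_ge0 ltW.
move=> fy; rewrite /sumr mulrBr.
have E (h : I -> R) : (esumr (fun i => Num.max (h i) 0)%R < +oo)%E ->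
    fine (esumr (fun i => Num.max (a * h i) 0)) =
    a * fine (esumr (fun i => Num.max (h i) 0)).
  move=> hy.
  have -> : (fun i => Num.max (a * h i) 0) = (fun i => a * Num.max (h i) 0).
    by apply/funext => i; rewrite maxr_pMr// mulr0.
  have h0 i : 0 <= Num.max (h i) 0 := m0 h i.
  by rewrite (esumrZ h0 a0) fineM// ge0_fin_numE// esumr_ge0.
rewrite E ?abs_summable_pos//; congr (_ - _).
under [in LHS]eq_fun do rewrite -mulrN.
by rewrite (E (fun i => - f i))// abs_summable_neg.
Qed.

Definition csum z : R[i] :=
  Complex (sumr (fun i => complex.Re (z i))) (sumr (fun i => complex.Im (z i))).

Definition csummable z :=
  abs_summable (fun i => complex.Re (z i)) /\
  abs_summable (fun i => complex.Im (z i)).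

Lemma csummableD z1 z2 : csummable z1 -> csummable z2 ->
  csummable (fun i => z1 i + z2 i).
Proof.
move=> [zr zi] [wr wi]; split.
  rewrite (_ : (fun _ => _) =
    (fun i => complex.Re (z1 i) + complex.Re (z2 i))); first exact: abs_summableD.
  by apply/funext => i; case: (z1 i) (z2 i) => [? ?] [? ?].
rewrite (_ : (fun _ => _) =
  (fun i => complex.Im (z1 i) + complex.Im (z2 i))); first exact: abs_summableD.
by apply/funext => i; case: (z1 i) (z2 i) => [? ?] [? ?].
Qed.

Lemma csumD z1 z2 : csummable z1 -> csummable z2 ->
  csum (fun i => z1 i + z2 i) = csum z1 + csum z2.
Proof.
move=> [zr zi] [wr wi]; rewrite /csum; simpc; rewrite -!sumrD//.
by congr Complex; congr sumr; apply/funext => i;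
  case: (z1 i) (z2 i) => [? ?] [? ?].
Qed.

Lemma csummableZ (a : R[i]) z : csummable z -> csummable (fun i => a * z i).
Proof.
case: a => a b [zr zi]; split.
  rewrite (_ : (fun _ => _) =
    (fun i => a * complex.Re (z i) + (- b) * complex.Im (z i))).
    by apply: abs_summableD; exact: abs_summableZ.
  by apply/funext => i; case: (z i) => ? ? /=; rewrite mulNr.
rewrite (_ : (fun _ => _) =
  (fun i => a * complex.Im (z i) + b * complex.Re (z i))).
  by apply: abs_summableD; exact: abs_summableZ.
by apply/funext => i; case: (z i) => ? ?.
Qed.

Lemma csumZ (a : R[i]) z : csummable z ->
  csum (fun i => a * z i) = a * csum z.
Proof.
case: a => a b [zr zi]; rewrite /csum; simpc; congr Complex.
  rewrite -mulNr -!sumrZ// -sumrD; [|exact: abs_summableZ..].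
  by congr sumr; apply/funext => i; case: (z i) => ? ? /=; rewrite mulNr.
rewrite -!sumrZ// -sumrD; [|exact: abs_summableZ..].
by congr sumr; apply/funext => i; case: (z i) => ? ? /=.
Qed.

Lemma csum_conj z : csum (fun i => Num.conj (z i)) = Num.conj (csum z).
Proof.
rewrite /csum conjCE /=; congr Complex; last rewrite -sumrN.
  by congr sumr; apply/funext => i; case: (z i) => ? ?.
by congr sumr; apply/funext => i; case: (z i) => ? ?.
Qed.

Lemma csum_ge0 f : (forall i, 0 <= f i) ->
  csum (fun i => (f i)%:C%C) = (fine (esumr f))%:C%C.
Proof.
move=> f0; rewrite /csum /= sumr_ge0E// (sumr_ge0E (f := fun=> 0))//.
by rewrite [X in Complex _ (fine X)]esum1.
Qed.

End sums.

Lemma complex_gt0P (R : realType) (e : R[i]) :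
  0 < e -> exists2 r : R, 0 < r & e = r%:C%C.
Proof.
move=> e0; have eE : e = (complex.Re e)%:C%C by rewrite RRe_real// gtr0_real.
by exists (complex.Re e) => //; rewrite -ltcR -eE.
Qed.

Lemma rnormD_sqr (R : realType) (V : normedModType R[i]) (x y : V) (t : R) :
  0 < t ->
  rnorm (x + y) ^+ 2 <= (1 + t) * rnorm x ^+ 2 + (1 + t^-1) * rnorm y ^+ 2.
Proof.
move=> t0; apply: (@le_trans _ _ ((rnorm x + rnorm y) ^+ 2)).
  by rewrite ler_sqr ?nnegrE ?addr_ge0 ?rnorm_ge0// rnormD.
set p := rnorm x; set q := rnorm y.
have : 0 <= t^-1 * (t * p - q) ^+ 2 by rewrite mulr_ge0 ?sqr_ge0// invr_ge0 ltW.
have -> : t^-1 * (t * p - q) ^+ 2 = t * p ^+ 2 + t^-1 * q ^+ 2 - 2 * p * q.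
  by field; rewrite gt_eqF.
by rewrite sqrrD; lra.
Qed.

Section hdot_bound.
Variables (R : realType) (V : hilbertType R).
Implicit Types x y z : V.

Lemma hdotC x y : hdot x y = Num.conj (hdot y x).
Proof. by rewrite hermC expr0 mul1r. Qed.

Lemma hdotDl x y z : hdot (x + y) z = hdot x z + hdot y z.
Proof. exact: linearDl. Qed.

Lemma hdotDr x y z : hdot x (y + z) = hdot x y + hdot x z.
Proof. exact: linearDr. Qed.

Lemma hdotZl a x y : hdot (a *: x) y = a * hdot x y.
Proof. exact: linearZl_LR. Qed.

Lemma hdotZr a x y : hdot x (a *: y) = Num.conj a * hdot x y.
Proof. exact: linearZr_LR. Qed.

Lemma Re_hdotxx x : complex.Re (hdot x x) = rnorm x ^+ 2.
Proof. by rewrite hdotxx rnormE -rmorphXn. Qed.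

Lemma Re_hdot x y :
  complex.Re (hdot x y) *+ 2 = rnorm (x + y) ^+ 2 - rnorm x ^+ 2 - rnorm y ^+ 2.
Proof.
rewrite -!Re_hdotxx hdotDl !hdotDr [hdot y x]hdotC conjCE.
case: (hdot x x) (hdot y y) (hdot x y) => [a b] [c d] [u v] /=.
by rewrite mulr2n; ring.
Qed.

Lemma Re_hdot_le x y : `|complex.Re (hdot x y)| <= rnorm x ^+ 2 + rnorm y ^+ 2.
Proof.
have := rnormD_sqr x y ltr01; have := Re_hdot x y.
have := sqr_ge0 (rnorm (x + y)).
have := sqr_ge0 (rnorm x); have := sqr_ge0 (rnorm y).
rewrite invr1 ler_norml mulr2n => *; apply/andP; split; lra.
Qed.

Lemma Im_hdot_le x y : `|complex.Im (hdot x y)| <= rnorm x ^+ 2 + rnorm y ^+ 2.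
Proof.
have := Re_hdot_le ((- 'i%C) *: x) y.
rewrite hdotZl rnormZ normrN normc_def/= expr0n add0r expr1n sqrtr1 mul1r.
by case: (hdot x y) => a b; simpc.
Qed.

End hdot_bound.

(* The Hilbert space direct sum of the H i. *)
Record hsum (R : realType) (I : choiceType) (H : I -> hilbertType R) := HSum {
  hsum_fun :> forall i, H i ;
  hsumP : (\esum_(i in [set: I]) (rnorm (hsum_fun i) ^+ 2)%:E < +oo)%E }.

HB.instance Definition _ R I H := gen_eqMixin (@hsum R I H).
HB.instance Definition _ R I H := gen_choiceMixin (@hsum R I H).

Section hsum.
Variables (R : realType) (I : choiceType) (H : I -> hilbertType R).
Local Notation V := (hsum H).
Implicit Types x y z : V.

Lemma hsum_ext x y : (forall i, x i = y i) -> x = y.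
Proof.
case: x y => [x hx] [y hy] /= xy.
have {}xy : x = y by apply: functional_extensionality_dep.
by subst y; congr HSum; exact: Prop_irrelevance.
Qed.

Let sqs (x : forall i, H i) : \bar R := esumr (fun i => rnorm (x i) ^+ 2).

Let sqs_ge0 (x : forall i, H i) : (0 <= sqs x)%E.
Proof. by apply: esumr_ge0 => i; exact: sqr_ge0. Qed.

Let sqsD (x y : forall i, H i) (t : R) : 0 < t ->
  (sqs (fun i => x i + y i)%R <= (1 + t)%R%:E * sqs x + (1 + t^-1)%R%:E * sqs y)%E.
Proof.
move=> t0; have t1 : 0 <= 1 + t by lra.
have t2 : 0 <= 1 + t^-1 by rewrite addr_ge0// invr_ge0 ltW.
have x0 i : 0 <= rnorm (x i) ^+ 2 by exact: sqr_ge0.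
have y0 i : 0 <= rnorm (y i) ^+ 2 by exact: sqr_ge0.
rewrite /sqs -(esumrZ x0 t1) -(esumrZ y0 t2) -esumrD.
- by apply: le_esumr => i; exact: rnormD_sqr.
- by move=> i; rewrite mulr_ge0.
- by move=> i; rewrite mulr_ge0.
Qed.

Let sqsZ (a : R[i]) (x : forall i, H i) :
  sqs (fun i => a *: x i) = ((complex.Re `|a| ^+ 2)%:E * sqs x)%E.
Proof.
rewrite /sqs -esumrZ ?sqr_ge0//; last by move=> i; exact: sqr_ge0.
by congr esumr; apply/funext => i; rewrite rnormZ exprMn.
Qed.

Let zeroP : (sqs (fun i => 0%R : H i) < +oo)%E.
Proof.
rewrite /sqs /esumr esum1// => i _.
by rewrite rnorm0 expr0n.
Qed.
Definition hsum_zero : V := HSum zeroP.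

Let addP x y : (sqs (fun i => x i + y i)%R < +oo)%E.
Proof.
apply: (le_lt_trans (sqsD x y ltr01)).
by rewrite lte_add_pinfty// lte_mul_pinfty// ?hsumP// lee_fin; lra.
Qed.
Definition hsum_add x y : V := HSum (addP x y).

Let scaleP a x : (sqs (fun i => a *: x i)%R < +oo)%E.
Proof. by rewrite sqsZ lte_mul_pinfty// ?hsumP// lee_fin sqr_ge0. Qed.
Definition hsum_scale a x : V := HSum (scaleP a x).

Let oppP x : (sqs (fun i => - x i)%R < +oo)%E.
Proof. by rewrite /sqs; under eq_fun do rewrite rnormN; exact: hsumP. Qed.
Definition hsum_opp x : V := HSum (oppP x).

Let addA : associative hsum_add.
Proof. by move=> x y z; apply: hsum_ext => i /=; rewrite addrA. Qed.
Let addC : commutative hsum_add.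
Proof. by move=> x y; apply: hsum_ext => i /=; rewrite addrC. Qed.
Let add0 : left_id hsum_zero hsum_add.
Proof. by move=> x; apply: hsum_ext => i /=; rewrite add0r. Qed.
Let addN : left_inverse hsum_zero hsum_opp hsum_add.
Proof. by move=> x; apply: hsum_ext => i /=; rewrite addNr. Qed.

HB.instance Definition _ := GRing.isZmodule.Build V addA addC add0 addN.

Lemma hsum_addE x y i : (x + y) i = x i + y i. Proof. by []. Qed.
Lemma hsum_oppE x i : (- x) i = - x i. Proof. by []. Qed.
Lemma hsum_0E i : (0 : V) i = 0. Proof. by []. Qed.

Let scaleA a b x : hsum_scale a (hsum_scale b x) = hsum_scale (a * b) x.
Proof. by apply: hsum_ext => i /=; rewrite scalerA. Qed.
Let scale1 : left_id 1 hsum_scale.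
Proof. by move=> x; apply: hsum_ext => i /=; rewrite scale1r. Qed.
Let scaleDr : right_distributive hsum_scale +%R.
Proof. by move=> a x y; apply: hsum_ext => i /=; rewrite scalerDr. Qed.
Let scaleDl x : {morph hsum_scale^~ x : a b / a + b}.
Proof. by move=> a b; apply: hsum_ext => i /=; rewrite scalerDl. Qed.

HB.instance Definition _ :=
  GRing.Zmodule_isLmodule.Build R[i] V scaleA scale1 scaleDr scaleDl.

Lemma hsum_scaleE a x i : (a *: x) i = a *: x i. Proof. by []. Qed.

Definition hsum_norm x : R := Num.sqrt (fine (sqs x)).

Let sqs_fin x : sqs x \is a fin_num.
Proof. by rewrite ge0_fin_numE// hsumP. Qed.

Let fine_sqs_ge0 x : 0 <= fine (sqs x).
Proof. by rewrite fine_ge0. Qed.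

Lemma hsum_normK x : (hsum_norm x ^+ 2)%:E =
  (\esum_(i in [set: I]) (rnorm (x i) ^+ 2)%:E)%E.
Proof. by rewrite sqr_sqrtr// fineK. Qed.

Let norm_ge0 x : 0 <= hsum_norm x. Proof. exact: sqrtr_ge0. Qed.

Let normD x y : hsum_norm (x + y) <= hsum_norm x + hsum_norm y.
Proof.
apply/ler_addgt0Pr => e e0.
set a := hsum_norm x + e / 2; set b := hsum_norm y + e / 2.
have a0 : 0 < a by rewrite ltr_wpDl// divr_gt0.
have b0 : 0 < b by rewrite ltr_wpDl// divr_gt0.
have -> : hsum_norm x + hsum_norm y + e = a + b by rewrite /a /b; field.
suff h : hsum_norm (x + y) ^+ 2 <= (a + b) ^+ 2.
  by move: h; rewrite ler_sqr ?nnegrE ?norm_ge0 ?(ltW (addr_gt0 a0 b0)).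
rewrite -lee_fin hsum_normK.
apply: (le_trans (sqsD x y (divr_gt0 b0 a0))).
rewrite -[sqs x]hsum_normK -[sqs y]hsum_normK -!EFinM -EFinD lee_fin.
have xa : hsum_norm x ^+ 2 <= a ^+ 2.
  by rewrite ler_sqr ?nnegrE ?(ltW a0)// lerDl divr_ge0// ltW.
have yb : hsum_norm y ^+ 2 <= b ^+ 2.
  by rewrite ler_sqr ?nnegrE ?(ltW b0)// lerDl divr_ge0// ltW.
have -> : (a + b) ^+ 2 = (1 + b / a) * a ^+ 2 + (1 + (b / a)^-1) * b ^+ 2.
  by field; rewrite !gt_eqF.
by rewrite lerD// ler_wpM2l// addr_ge0// ?invr_ge0 divr_ge0// ltW.
Qed.

Let cnorm x : R[i] := (hsum_norm x)%:C%C.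

Let cnormD x y : cnorm (x + y) <= cnorm x + cnorm y.
Proof. by rewrite /cnorm -rmorphD lecR. Qed.

Let cnormZ a x : cnorm (a *: x) = `|a| * cnorm x.
Proof.
rewrite /cnorm /hsum_norm sqsZ fineM// sqrtrM ?sqr_ge0// sqrtr_sqr rmorphM.
congr (_ * _); rewrite normc_def/= ger0_norm ?sqrtr_ge0//.
Qed.

Let cnorm0 x : cnorm x = 0 -> x = 0.
Proof.
move=> /complexI /eqP; rewrite sqrtr_eq0 => x0; apply: hsum_ext => i.
apply: rnorm0_eq0; apply/eqP; rewrite -sqrf_eq0 eq_le sqr_ge0 andbT.
rewrite -lee_fin (le_trans _ (_ : sqs x <= 0)%E)//.
  have := esumr_ge (fun i => rnorm (x i) ^+ 2) (finite_set1 i).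
  by rewrite fsbig_set1.
by rewrite -[sqs x]fineK// lee_fin.
Qed.

HB.instance Definition _ :=
  Lmodule_isNormed.Build R[i] V cnormD cnormZ cnorm0.

Lemma hsum_normE x : `|x| = (hsum_norm x)%:C%C. Proof. by []. Qed.

Lemma hsum_rnormE x : rnorm x = hsum_norm x. Proof. by []. Qed.

Lemma hsum_sqrnormE x :
  (rnorm x ^+ 2)%:E = (\esum_(i in [set: I]) (rnorm (x i) ^+ 2)%:E)%E.
Proof. exact: hsum_normK. Qed.

Definition hsum_dot x y : R[i] := csum (fun i => hdot (x i) (y i)).

Let dot_summable x y : csummable (fun i => hdot (x i) (y i)).
Proof.
have h : (esumr (fun i => (rnorm (x i) ^+ 2 + rnorm (y i) ^+ 2)%R) < +oo)%E.
  rewrite esumrD; do ?[by move=> i; exact: sqr_ge0].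
  by rewrite lte_add_pinfty ?hsumP.
split; apply: le_lt_trans h; apply: le_esumr => i.
  exact: Re_hdot_le.
exact: Im_hdot_le.
Qed.

Let dot_herm x y : hsum_dot x y = (-1) ^+ false * Num.conj (hsum_dot y x).
Proof.
rewrite expr0 mul1r /hsum_dot -csum_conj; congr csum.
by apply/funext => i; rewrite -hdotC.
Qed.

Let dot_linear_l y : linear_for *%R (hsum_dot^~ y).
Proof.
move=> a u v; rewrite /hsum_dot -csumZ// -csumD//; last exact: csummableZ.
by congr csum; apply/funext => i /=; rewrite hdotDl hdotZl.
Qed.

Let dot_bilinear : bilinear_for *%R (Num.Def.conjC \; *%R) hsum_dot.
Proof.
split=> [y|y a u v]; first exact: dot_linear_l.
rewrite dot_herm dot_linear_l expr0 mul1r rmorphD rmorphM /=.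
by rewrite [hsum_dot y u]dot_herm [hsum_dot y v]dot_herm !expr0 !mul1r.
Qed.

HB.instance Definition _ := bilinear_isBilinear.Build R[i] V V R[i]
  *%R (Num.Def.conjC \; *%R) hsum_dot dot_bilinear.

HB.instance Definition _ := isHermitianSesquilinear.Build R[i] V
  false Num.Def.conjC hsum_dot dot_herm.

Let dotxx x : hsum_dot x x = `|x| ^+ 2.
Proof.
rewrite hsum_normE -rmorphXn /hsum_dot; set f := fun i => _.
have -> : f = (fun i => (rnorm (x i) ^+ 2)%:C%C).
  by apply/funext => i; rewrite /f hdotxx rnormE rmorphXn.
rewrite csum_ge0; last by move=> i; exact: sqr_ge0.
have -> : fine (esumr (fun i => rnorm (x i) ^+ 2)) = hsum_norm x ^+ 2.
  by apply: EFin_inj; rewrite hsum_normK; exact: fineK (sqs_fin x).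
by [].
Qed.

Let dot_gt0 x : x != 0 -> 0 < hsum_dot x x.
Proof. by move=> x0; rewrite dotxx exprn_gt0// normr_gt0. Qed.

HB.instance Definition _ := isDotProduct.Build R[i] V hsum_dot dot_gt0.

Lemma hsum_rnorm_coord x i : rnorm (x i) <= rnorm x.
Proof.
have := esumr_ge (fun i => rnorm (x i) ^+ 2) (finite_set1 i).
have -> : esumr (fun i => rnorm (x i) ^+ 2) = (rnorm x ^+ 2)%:E.
  by rewrite hsum_sqrnormE.
rewrite fsbig_set1 lee_fin.
by rewrite ler_sqr ?nnegrE ?rnorm_ge0.
Qed.

Let ltr_rnorm (W : normedModType R[i]) (w : W) (e : R) :
  (`|w| < e%:C%C) = (rnorm w < e).
Proof. by rewrite rnormE ltcR. Qed.

Let hsum_complete (F : set_system V) : ProperFilter F -> cauchy F -> cvg F.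
Proof.
move=> FF /cauchy_ballP cF.
have cR (e : R) : 0 < e -> exists A B : set V,
    [/\ F A, F B & forall x x', A x -> B x' -> rnorm (x - x') < e].
  move=> e0; have : 0 < e%:C%C :> R[i] by rewrite ltcR.
  move/cF => [[A B]/= [FA FB] AB]; exists A, B; split => // x x' Ax Bx'.
  have := AB (x, x') (conj Ax Bx').
  by rewrite -ball_normE/= ltr_rnorm.
have ccoord i : cvg ((fun x : V => x i) @ F).
  apply: cauchy_cvg; apply/cauchy_ballP => _ /complex_gt0P[e e0 ->].
  have [A [B [FA FB AB]]] := cR _ e0.
  exists ((fun x : V => x i) @` A, (fun x : V => x i) @` B) => /=.
    split; rewrite /nbhs/=.
      by apply: filterS FA => z Az; exists z.
    by apply: filterS FB => z Bz; exists z.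
  move=> [_ _] /= [[x Ax <-] [x' Bx' <-]].
  rewrite -ball_normE/= ltr_rnorm; apply: le_lt_trans (AB _ _ Ax Bx').
  exact: hsum_rnorm_coord (x - x') i.
pose y i := lim ((fun x : V => x i) @ F).
have cy i : (fun x : V => x i) @ F --> y i by exact: ccoord.
have le_y (e : R) : 0 < e ->
    F [set x : V | (sqs (fun i => x i - y i)%R <= (e ^+ 2)%:E)%E].
  move=> e0; have [A [B [FA FB AB]]] := cR _ e0.
  apply: filterS FA => x Ax /=; apply: esumr_le => D fD.
  rewrite fsbig_finite//.
  have cs : ((fun x' : V => \sum_(i <- finmap.enum_fset (fset_set D))
      rnorm (x i - x' i) ^+ 2) @ F) --> \sum_(i <- finmap.enum_fset (fset_set D)) rnorm (x i - y i) ^+ 2.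
    apply: cvg_big => [|i _]; first exact: add_continuous.
    have cn : ((fun x' : V => rnorm (x i - x' i)) @ F) --> rnorm (x i - y i).
      apply/cvgrPdist_lt => d d0.
      have /cvgrPdist_lt/(_ d%:C%C) := cy i; rewrite ltcR => /(_ d0).
      apply: filterS => x'; rewrite ltr_rnorm; apply: le_lt_trans.
      have rB (u v : H i) : rnorm u - rnorm v <= rnorm (u - v).
        by rewrite lerBlDr (le_trans _ (rnormD _ _))// subrK.
      have E : x i - y i - (x i - x' i) = - (y i - x' i).
        by rewrite !opprB addrC addrA subrK.
      rewrite ler_norml; apply/andP; split.
        by rewrite lerNl opprB (le_trans (rB _ _))// rnormB E rnormN.
      by rewrite (le_trans (rB _ _))// E rnormN.
    by rewrite expr2; apply: cvgM.
  apply: (cvgr_to_le cs).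
  apply: filterS FB => x' Bx'.
  have : rnorm (x - x') ^+ 2 <= e ^+ 2.
    by rewrite ler_sqr ?nnegrE ?rnorm_ge0 ?(ltW e0)// ltW// AB.
  apply: le_trans; rewrite -fsbig_finite// -lee_fin hsum_sqrnormE.
  exact: (esumr_ge (fun i => rnorm (x i - x' i) ^+ 2)).
have [x0 /= hx0] := filter_ex (le_y 1 ltr01).
have dP : (sqs (fun i => x0 i - y i)%R < +oo)%E.
  by apply: le_lt_trans hx0 _; rewrite ltry.
pose y0 : V := x0 - HSum dP.
have y0E i : y0 i = y i by rewrite /y0 hsum_addE hsum_oppE/= opprB addrC subrK.
apply/cvg_ex; exists y0; apply/cvgrPdist_lt => _ /complex_gt0P[e e0 ->].
have e20 : 0 < e / 2 by rewrite divr_gt0.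
apply: filterS (le_y _ e20) => x /= hx; rewrite ltr_rnorm.
apply: (@le_lt_trans _ _ (e / 2)); last by rewrite ltr_pdivrMr// ltr_pMr// ltr1n.
rewrite -ler_sqr ?nnegrE ?rnorm_ge0 ?(ltW e20)// -lee_fin hsum_sqrnormE.
apply: le_trans hx; apply: le_esumr => i.
by rewrite hsum_addE hsum_oppE y0E rnormB.
Qed.

HB.instance Definition _ := Uniform_isComplete.Build V hsum_complete.

HB.instance Definition _ := isHilbert.Build R V dotxx.

End hsum.

(* Operators are graphs, so that unbounded operators, their domains, adjoints,
   closures and inverses are all plain sets of pairs. *)
Definition operator (R : realType) (H : hilbertType R) := set (H * H).

Section operators.
Variables (R : realType) (H : hilbertType R).
Implicit Types (A B : operator H) (E : set H) (s : R).

Definition op_dom A : set H := [set x | exists y, A (x, y)].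

Definition op_id : operator H := [set p | p.2 = p.1].

Definition op_comp A B : operator H :=
  [set p | exists2 y, B (p.1, y) & A (y, p.2)].

Definition op_add A B : operator H :=
  [set p | exists y z, [/\ A (p.1, y), B (p.1, z) & p.2 = y + z]].

Definition op_scale (a : R[i]) A : operator H :=
  [set p | exists2 y, A (p.1, y) & p.2 = a *: y].

Definition op_inv A : operator H := [set p | A (p.2, p.1)].

Definition op_restrict A E : operator H := [set p | A p /\ E p.1].

Definition op_adjoint A : operator H :=
  [set p | forall q, A q -> hdot q.2 p.1 = hdot q.1 p.2].

Definition op_commutator A B : operator H :=
  op_add (op_comp A B) (op_scale (-1) (op_comp B A)).

Definition linear_op A :=
  [/\ A (0, 0),
      forall (a : R[i]) p q, A p -> A q -> A (a *: p + q) &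
      forall x y z, A (x, y) -> A (x, z) -> y = z].

Definition op_norm A : \bar R :=
  ereal_sup [set (rnorm p.2)%:E | p in [set p | A p /\ rnorm p.1 <= 1]].

Definition bounded_op A :=
  [/\ linear_op A, op_dom A = setT & (op_norm A < +oo)%E].

Definition compact_op A :=
  bounded_op A /\
  precompact [set p.2 | p in [set p | A p /\ rnorm p.1 <= 1]].

Definition self_adjoint A :=
  [/\ linear_op A, dense (op_dom A) & op_adjoint A = A].

Definition lin_span E : set H :=
  [set x | exists (r : seq H) (c : H -> R[i]),
    [set` r] `<=` E /\ x = \sum_(e <- r) c e *: e].

Definition orthonormal_basis E :=
  [/\ forall e, E e -> hdot e e = 1,
      forall e e', E e -> E e' -> e != e' -> hdot e e' = 0 &
      dense (lin_span E)].

(* B = A^s for a bounded positive operator A with an orthonormal basis of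
   eigenvectors, as a compact positive operator has by the spectral theorem:
   A^s multiplies each eigenvector of eigenvalue l by l^s. *)
Definition op_power A s B :=
  [/\ bounded_op A, bounded_op B &
      exists2 E, orthonormal_basis E &
        forall e, E e -> exists l : R,
          [/\ 0 <= l, A (e, l%:C%C *: e) & B (e, (l `^ s)%:C%C *: e)]].

(* The trace sum of an everywhere defined positive operator A along E. *)
Definition trace_along E A : \bar R :=
  (\esum_(p in op_restrict A E) (complex.Re (hdot p.2 p.1))%:E)%E.

(* For a positive operator the trace does not depend on the basis. *)
Definition finite_trace A :=
  exists2 E, orthonormal_basis E & (trace_along E A < +oo)%E.

End operators.
Arguments op_id {R H}.

(* The data of a triple (C(T), H, D). A representation is given on all functions
   but only its values at continuous ones matter. Commutators with D are formed
   on the subspace [core] of H. *)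
Record triple (R : realType) (T : metricType R) := Triple {
  space : hilbertType R ;
  rep : (T -> R[i]^o) -> operator space ;
  dirac : operator space ;
  core : set space }.
Arguments rep {R T} t f _ : rename.
Arguments dirac {R T} t _ : rename.
Arguments core {R T} t _ : rename.

Section spectral_triples.
Variables (R : realType) (T : metricType R).
Local Notation triple := (triple T).
Implicit Types (ST : triple) (f g : T -> R[i]^o).

Definition unital_representation (H : hilbertType R)
    (rho : (T -> R[i]^o) -> operator H) :=
  [/\ forall f, continuous f -> bounded_op (rho f),
      rho (fun=> 1) = op_id,
      forall (a : R[i]) f g, continuous f -> continuous g ->
        rho (fun t => a * f t + g t) = op_add (op_scale a (rho f)) (rho g),
      forall f g, continuous f -> continuous g ->
        rho (fun t => f t * g t) = op_comp (rho f) (rho g) &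
      forall f, continuous f ->
        rho (fun t => Num.conj (f t : R[i])) = op_adjoint (rho f)].

Definition commutator_norm ST f : \bar R :=
  op_norm (op_restrict (op_commutator (dirac ST) (rep ST f)) (core ST)).

(* (I + D^2)^-1 *)
Definition resolvent ST : operator (space ST) :=
  op_inv (op_add op_id (op_comp (dirac ST) (dirac ST))).
Arguments resolvent ST _ : clear implicits.

Definition commutators_defined ST :=
  closure (op_restrict (dirac ST) (core ST)) = dirac ST /\
  forall f, continuous f ->
    core ST `<=` op_dom (op_commutator (dirac ST) (rep ST f)).

Definition spectral_triple ST :=
  [/\ unital_representation (rep ST),
      self_adjoint (dirac ST),
      commutators_defined ST,
      forall f (e : R), continuous f -> 0 < e -> exists g,
        [/\ continuous g, (commutator_norm ST g < +oo)%E &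
            forall t, rnorm (f t - g t) <= e] &
      compact_op (resolvent ST)].

(* tr ((I + D^2)^(-p/2)) < oo *)
Definition p_summable ST (p : R) :=
  exists2 B, op_power (resolvent ST) (p / 2) B & finite_trace B.

Definition state_dist ST (phi psi : (T -> R[i]^o) -> R[i]^o) : \bar R :=
  ereal_sup [set (rnorm (phi f - psi f))%:E |
    f in [set f | continuous f /\ (commutator_norm ST f <= 1)%E]].

Definition induced_dist ST (s t : T) : \bar R :=
  state_dist ST (fun f => f s) (fun f => f t).

Local Notation C2 := (hsum (fun _ : 'I_2 => complex_line R)).

Definition two_point_triple (x y : T) : triple :=
  @Triple R T C2
    (fun f => [set p : C2 * C2 | p.2 0 = (f x : R[i]) *: p.1 0 /\
                                 p.2 1 = (f y : R[i]) *: p.1 1])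
    [set p : C2 * C2 | p.2 0 = ((mdist x y)^-1)%:C%C *: p.1 1 /\
                       p.2 1 = ((mdist x y)^-1)%:C%C *: p.1 0]
    setT.

Definition finite_support (I : choiceType) (H : I -> hilbertType R) :
    set (hsum H) :=
  [set v | finite_set [set i | v i != 0]].

Definition direct_sum (I : choiceType) (S : I -> triple) : triple :=
  let H := hsum (fun i => space (S i)) in
  @Triple R T H
    (fun f => [set p : H * H | forall i, rep (S i) f (p.1 i, p.2 i)])
    (closure [set p : H * H | finite_support p.1 /\
                              forall i, dirac (S i) (p.1 i, p.2 i)])
    [set v : H | finite_support v /\ forall i, core (S i) (v i)].

(* A set of unordered pairs of non-equal points, each pair {x, y} being
   represented by exactly one of (x, y) and (y, x). *)
Definition unordered_pairs (J : set (T * T)) :=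
  forall p, J p -> p.1 <> p.2 /\ ~ J (p.2, p.1).

Definition pairs_triple (J : set (T * T)) : triple :=
  direct_sum (fun p : J => two_point_triple (val p).1 (val p).2).

End spectral_triples.
Arguments resolvent {R T} ST _.

Section minkowski.
Variables (R : realType) (T : metricType R).

Definition covering_number (r : R) : R :=
  inf [set n%:R | n in [set n : nat | exists2 c : seq T, size c = n &
    forall t, exists2 x, x \in c & mdist x t <= r]].

Definition upper_minkowski_dim : \bar R :=
  limf_esup (fun r : R => (ln (covering_number r) / - ln r)%:E) 0^'+.

End minkowski.

(* Main.v *)
(* For each n take a maximal 2^-n-separated (hence finite and 2^-n-dense) set F_n,
   and let J consist of the pairs of distinct points of F_n and F_(n+1) at
   distance at most C 2^-n, for a large constant C depending on delta and on the
   diameter. A function f has ||[D, f]|| <= 1 exactly when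
   |f x - f y| <= d(x, y) on J. For s <> t choose the scale n with 2^-n of the
   order of delta d(s, t): the net points near s and t form a pair of J, and
   each is joined to s or t by a chain of net points of the finer scales whose
   length is at most 3 * 2^-n; this bounds the induced metric by (1 + delta) d.
   The operator (I + D^2)^-1 is diagonal with entries d^2 / (1 + d^2) <= d^2.
   Level n has at most (2 N_(2^-(n+2)))^2 pairs, of length at most C 2^-n, so
   the trace of the power s/2 is dominated by a geometric series as soon as
   s > 2 dim. Conversely, if T is connected then every point of F_n has a
   neighbour in F_n at distance between 2^-n and 2 * 2^-n, which gives at least
   |F_n| / 2 pairs of J of length at least 2^-n; a finite trace then bounds
   |F_n| >= N_(2^-n) by a multiple of 2^(n s). *)
Require Import Defs.
From mathcomp Require Import all_boot all_order all_algebra.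
From mathcomp Require Import all_classical all_reals all_analysis.
From mathcomp Require Import complex ring lra.
Set Implicit Arguments.
Unset Strict Implicit.
Unset Printing Implicit Defensive.
Import Order.TTheory GRing.Theory Num.Theory numFieldNormedType.Exports.
Local Open Scope classical_set_scope.
Local Open Scope ring_scope.

(** * Norms and inner products *)

(** Two consecutive nets share a level because a chain must be able to step from [F n] to [F n.+1]
    within [J]. The exponents in (2) and (3) differ by a factor 2 because the upper bound counts all
    pairs of points of a level, hence the square of a covering number, while the lower bound is only
    guaranteed about one pair per net point. On the operator side everything is block diagonal, but
    the norms of the Dirac blocks need not be uniformly bounded, and an equality of graphs includes
    an equality of domains. So the closure, the adjoint and the resolvent are each identified with a
    block operator on its largest possible domain, after which only computations with 2 x 2 blocks
    remain. Summability asks for some power of the resolvent and some orthonormal basis with finite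
    trace. For (2) the coordinate basis serves. For (3) both are given and unknown: the power has to
    be identified with the diagonal one, and its trace bounded below along an arbitrary basis. *)

Section rnorm_topology.
Variables (R : realType) (V : normedModType R[i]).
Implicit Types (x y z : V) (A : set V) (e : R).

Lemma ball_rnorm x y e : ball x e%:C%C y <-> rnorm (x - y) < e.
Proof. by rewrite -ball_normE/= rnormE ltcR. Qed.

Lemma rnorm_triangle z x y : rnorm (x - y) <= rnorm (x - z) + rnorm (z - y).
Proof. by rewrite -(subrKA z) rnormD. Qed.

Lemma rnorm_nbhsP x A :
  nbhs x A <-> exists2 e, 0 < e & forall y, rnorm (x - y) < e -> A y.
Proof.
split=> [/nbhs_ballP[_ /= /complex_gt0P[e e0 ->] xA]|[e e0 xA]].
  by exists e => // y /ball_rnorm/xA.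
by apply/nbhs_ballP; exists e%:C%C => /= [|y /ball_rnorm/xA//]; rewrite ltcR.
Qed.

Lemma rnorm_closureP A x :
  closure A x <-> forall e, 0 < e -> exists2 a, A a & rnorm (x - a) < e.
Proof.
split=> [Ax e e0|Ax B /rnorm_nbhsP[e e0 eB]].
  have /Ax[a [Aa xa]] : nbhs x [set y | rnorm (x - y) < e].
    by apply/rnorm_nbhsP; exists e.
  by exists a.
by have [a Aa /eB Ba] := Ax e e0; exists a.
Qed.

Lemma rnorm_denseP A :
  dense A <-> forall x e, 0 < e -> exists2 a, A a & rnorm (x - a) < e.
Proof.
split=> [dA x e e0|dA B [x Bx] oB].
  suff /rnorm_closureP/(_ _ e0) : closure A x by [].
  move=> B /=; rewrite nbhsE => -[U [oU Ux] UB].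
  have [a [Ua Aa]] := dA U (ex_intro _ x Ux) oU.
  by exists a; split=> //; exact: UB.
have /rnorm_nbhsP[e e0 eB] : nbhs x B by exact: open_nbhs_nbhs.
by have [a Aa /eB Ba] := dA x e e0; exists a.
Qed.

Lemma rnorm_sum (I : Type) (r : seq I) (P : pred I) (F : I -> V) :
  rnorm (\sum_(i <- r | P i) F i) <= \sum_(i <- r | P i) rnorm (F i).
Proof.
elim/big_rec2: _ => [|i y x _ h]; first by rewrite rnorm0.
by rewrite (le_trans (rnormD _ _))// lerD2l.
Qed.

Lemma rnorm_eq0P x : (forall e, 0 < e -> rnorm x <= e) -> x = 0.
Proof.
move=> h; apply: rnorm0_eq0; apply/eqP; rewrite eq_le rnorm_ge0 andbT.
by apply/ler_addgt0Pr => e /h; rewrite add0r.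
Qed.

Lemma rnormZr (a : R) x : rnorm (a%:C%C *: x) = `|a| * rnorm x.
Proof. by rewrite rnormZ normc_def/= expr0n addr0 sqrtr_sqr. Qed.

End rnorm_topology.

Lemma rnorm_closure_pairP (R : realType) (V : normedModType R[i])
    (A : set (V * V)) x y :
  closure A (x, y) <-> forall e : R, 0 < e -> exists p, [/\ A p,
    rnorm (x - p.1) < e & rnorm (y - p.2) < e].
Proof.
split=> [Axy e e0|Axy B [[B1 B2] /= [/rnorm_nbhsP[e1 e10 B1e]
    /rnorm_nbhsP[e2 e20 B2e]] BB]].
  have [|p [Ap [xp yp]]] := Axy
      ([set z | rnorm (x - z) < e] `*` [set z | rnorm (y - z) < e]).
    exists ([set z | rnorm (x - z) < e], [set z | rnorm (y - z) < e]) => //=.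
    by split; apply/rnorm_nbhsP; exists e.
  by exists p.
have e0 : 0 < Num.min e1 e2 by rewrite lt_min e10.
have [[p q] [Ap]] := Axy _ e0; rewrite /= !lt_min => /andP[h1 _] /andP[_ h2].
exists (p, q); split=> //; apply: BB; split; [exact: B1e|exact: B2e].
Qed.

Section hdot_facts.
Variables (R : realType) (H : hilbertType R).
Implicit Types (x y z : H) (A : operator H).

Lemma hdotBr x y z : hdot x (y - z) = hdot x y - hdot x z.
Proof. by rewrite -scaleN1r hdotDr hdotZr rmorphN rmorph1 mulN1r. Qed.

Lemma hdot0l y : hdot 0 y = 0.
Proof. by rewrite -[X in hdot X y](scale0r (0 : H)) hdotZl mul0r. Qed.

Lemma hdot_sumr (I : Type) (r : seq I) (P : pred I) (F : I -> H) x :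
  hdot x (\sum_(i <- r | P i) F i) = \sum_(i <- r | P i) hdot x (F i).
Proof.
apply: (big_ind2 (fun u v => hdot x u = v)) => //.
  by rewrite hdotC hdot0l rmorph0.
by move=> u1 v1 u2 v2 <- <-; rewrite hdotDr.
Qed.

Lemma hdot_inj x y : (forall z, hdot z x = hdot z y) -> x = y.
Proof.
move=> h; apply/eqP; rewrite -subr_eq0; apply/eqP; apply: rnorm0_eq0.
by apply/eqP; rewrite -sqrf_eq0 -Re_hdotxx hdotBr h subrr.
Qed.

Lemma op_normP A (M : R) : (forall p, A p -> rnorm p.2 <= M * rnorm p.1) ->
  0 <= M -> (op_norm A <= M%:E)%E.
Proof.
move=> AM M0; apply: ge_ereal_sup => _ /= [p [Ap p1] <-]; rewrite lee_fin.
by rewrite (le_trans (AM _ Ap))// ler_piMr.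
Qed.

(** [op_norm] tests the unit ball only; rescaling extends the bound to all vectors. A vector of norm
    zero is handled by single-valuedness of the graph. *)
Lemma op_norm_le A (M : R) p : linear_op A -> (op_norm A <= M%:E)%E -> A p ->
  rnorm p.2 <= M * rnorm p.1.
Proof.
move=> [A0 Al Af] AM Ap.
have [p0|p0] := eqVneq (rnorm p.1) 0.
  rewrite p0 mulr0; case: p p0 Ap => u v /= /rnorm0_eq0 ->{u} Ap.
  by rewrite (Af _ _ _ Ap A0) rnorm0.
have p_gt0 : 0 < rnorm p.1 by rewrite lt0r p0 rnorm_ge0.
rewrite -ler_pdivrMr// mulrC -[X in X * _]ger0_norm ?invr_ge0 ?rnorm_ge0//.
rewrite -rnormZr -lee_fin; apply: le_trans AM; apply: ereal_sup_ubound => /=.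
exists (((rnorm p.1)^-1)%:C%C *: p) => //; split.
  by rewrite -[_ *: p]addr0; exact: Al.
by rewrite /= rnormZr ger0_norm ?invr_ge0 ?rnorm_ge0// mulVf.
Qed.

End hdot_facts.

(** * Hilbert space direct sums *)

Section esumr_single.
Variables (R : realType) (I : choiceType).

Lemma esumr_single (f : I -> R) i : 0 <= f i -> (forall j, j != i -> f j = 0) ->
  esumr f = (f i)%:E.
Proof.
move=> fi0 f0; rewrite -(esum_set1 (a := fun j => (f j)%:E)) ?lee_fin//.
rewrite [RHS]esum_mkcond; apply: eq_esum => j _.
case: ifPn => // /negP jA; rewrite f0//; apply/eqP => ji.
by apply: jA; rewrite inE.
Qed.

Lemma sumr_single (f : I -> R) i : (forall j, j != i -> f j = 0) ->
  sumr f = f i.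
Proof.
move=> f0; rewrite /sumr !(@esumr_single _ i) ?le_max ?lexx ?orbT//=.
- by case: (leP (f i) 0) => h1; case: (leP (- f i) 0) => h2; lra.
- by move=> j /f0 ->; rewrite oppr0 maxxx.
- by move=> j /f0 ->; rewrite maxxx.
Qed.

Lemma csum_single (z : I -> R[i]) i : (forall j, j != i -> z j = 0) ->
  csum z = z i.
Proof.
move=> z0; rewrite /csum !(@sumr_single _ i); first by case: (z i).
all: by move=> j /z0 ->.
Qed.

End esumr_single.

Section hsum_facts.
Variables (R : realType) (I : choiceType) (H : I -> hilbertType R).
Local Notation V := (hsum H).
Implicit Types (x y : V) (A : set I) (i : I).

Lemma sqrnormE x : (rnorm x ^+ 2)%:E = esumr (fun i => rnorm (x i) ^+ 2).
Proof. exact: hsum_sqrnormE. Qed.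

Lemma hsum_hdotE x y : hdot x y = csum (fun i => hdot (x i) (y i)).
Proof. by []. Qed.

Lemma hsum_rnorm_le x y (M : R) : 0 <= M ->
  (forall i, rnorm (y i) <= M * rnorm (x i)) -> rnorm y <= M * rnorm x.
Proof.
move=> M0 yx; rewrite -ler_sqr ?nnegrE ?mulr_ge0 ?rnorm_ge0// exprMn.
rewrite -lee_fin [leRHS]EFinM !sqrnormE -esumrZ ?sqr_ge0//; last first.
  by move=> i; exact: sqr_ge0.
apply: le_esumr => i; rewrite -exprMn.
by rewrite ler_sqr ?nnegrE ?mulr_ge0 ?rnorm_ge0.
Qed.

Lemma hsum_dominated x (y : forall i, H i) (M : R) :
  (forall i, rnorm (y i) <= M * rnorm (x i)) ->
  (esumr (fun i => rnorm (y i) ^+ 2)%R < +oo)%E.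
Proof.
move=> yx; apply: (@le_lt_trans _ _ (M ^+ 2 * rnorm x ^+ 2)%:E); last first.
  exact: ltry.
rewrite [leRHS]EFinM sqrnormE -esumrZ ?sqr_ge0//; last first.
  by move=> i; exact: sqr_ge0.
apply: le_esumr => i; rewrite -exprMn ler_sqr ?nnegrE ?rnorm_ge0//.
by rewrite (le_trans _ (yx i))// rnorm_ge0.
Qed.

Lemma hsum_exists x (y : forall i, H i) (M : R) :
  (forall i, rnorm (y i) <= M * rnorm (x i)) ->
  exists z : V, forall i, z i = y i.
Proof. by move=> yx; exists (HSum (hsum_dominated yx)). Qed.

Lemma hrestrict_subproof A x :
  (esumr (fun i => rnorm (if i \in A then x i else 0) ^+ 2)%R < +oo)%E.
Proof.
apply: (@hsum_dominated x _ 1) => i; rewrite mul1r.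
by case: ifP; rewrite ?rnorm0 ?rnorm_ge0.
Qed.

(* The vectors below are taken from opaque existence proofs so that
   simplification never unfolds their coordinates. *)
Fact hrestrict_key A x : {y : V | forall i, y i = if i \in A then x i else 0}.
Proof. by exists (HSum (hrestrict_subproof A x)). Qed.

Definition hrestrict A x : V := sval (hrestrict_key A x).

Lemma hrestrictE A x i : hrestrict A x i = if i \in A then x i else 0.
Proof. exact: (svalP (hrestrict_key A x)). Qed.

Lemma hrestrictC A x : x - hrestrict A x = hrestrict (~` A) x.
Proof.
apply: hsum_ext => i; rewrite hsum_addE hsum_oppE !hrestrictE in_setC.
by case: ifP; rewrite ?subrr ?subr0.
Qed.

Lemma hrestrictB A x y : hrestrict A (x - y) = hrestrict A x - hrestrict A y.
Proof.
apply: hsum_ext => i; rewrite !(hsum_addE, hsum_oppE, hrestrictE).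
by case: ifP; rewrite ?subrr.
Qed.

Lemma hrestrict_le A x : rnorm (hrestrict A x) <= rnorm x.
Proof.
rewrite -[leRHS]mul1r; apply: hsum_rnorm_le => // i; rewrite hrestrictE mul1r.
by case: ifP; rewrite ?rnorm0 ?rnorm_ge0.
Qed.

Lemma hrestrict_support A x : finite_set A -> Defs.finite_support (hrestrict A x).
Proof.
move=> fA; apply: sub_finite_set fA => i /=; rewrite hrestrictE.
by case: ifP => [/set_mem//|_ /eqP].
Qed.

Lemma sqrnorm_hrestrict A x : finite_set A ->
  rnorm (hrestrict A x) ^+ 2 = \sum_(i \in A) rnorm (x i) ^+ 2.
Proof.
move=> fA; apply: EFin_inj; rewrite sqrnormE -fsumEFin//.
rewrite -esum_fset// => [|i _]; last by rewrite lee_fin sqr_ge0.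
rewrite [RHS]esum_mkcond; apply: eq_esum => i _; rewrite hrestrictE.
by case: ifP; rewrite ?rnorm0 ?expr0n.
Qed.

(** Some finite partial sum comes within [e ^+ 2] of the squared norm, and by Pythagoras what is
    missing is the squared norm of the tail. *)
Lemma hrestrict_tail x (e : R) : 0 < e ->
  exists2 A, finite_set A & rnorm (x - hrestrict A x) < e.
Proof.
move=> e0.
have [_ [A [fA _] <-]] : exists2 y : \bar R,
    [set \sum_(i \in A) (rnorm (x i) ^+ 2)%R%:E | A in fsets setT]%E y &
    ((rnorm x ^+ 2)%:E - (e ^+ 2)%:E < y)%E.
  rewrite [(rnorm x ^+ 2)%:E]sqrnormE; apply: ub_ereal_sup_adherent.
    by rewrite exprn_gt0.
  by rewrite -[ereal_sup _]/(esumr (fun i => rnorm (x i) ^+ 2)) -sqrnormE.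
rewrite fsumEFin// -sqrnorm_hrestrict// -EFinB lte_fin => h.
exists A => //; rewrite -ltr_sqr ?nnegrE ?rnorm_ge0 ?ltW//.
suff : rnorm x ^+ 2 = rnorm (hrestrict A x) ^+ 2 + rnorm (x - hrestrict A x) ^+ 2.
  by move: h; lra.
apply: EFin_inj; rewrite EFinD !sqrnormE -esumrD; do ?[by move=> i; exact: sqr_ge0].
congr esumr; apply/funext => i; rewrite hrestrictC !hrestrictE in_setC.
by case: ifP; rewrite rnorm0 expr0n ?addr0 ?add0r.
Qed.

Lemma hsingle_subproof i (v : H i) :
  (esumr (fun j => rnorm (dfwith (fun k => 0 : H k) i v j) ^+ 2)%R < +oo)%E.
Proof.
rewrite (@esumr_single _ _ _ i) ?sqr_ge0 ?ltry// => j ji.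
by rewrite dfwithout 1?eq_sym// rnorm0 expr0n.
Qed.

Fact hsingle_key i (v : H i) :
  {y : V | forall j, y j = dfwith (fun k => 0 : H k) i v j}.
Proof. by exists (HSum (hsingle_subproof v)). Qed.

Definition hsingle i (v : H i) : V := sval (hsingle_key v).

Lemma hsingle_in i (v : H i) : hsingle v i = v.
Proof. by rewrite (svalP (hsingle_key v)) dfwithin. Qed.

Lemma hsingle_out i (v : H i) j : j != i -> hsingle v j = 0.
Proof. by move=> ji; rewrite (svalP (hsingle_key v)) dfwithout 1?eq_sym. Qed.

Lemma rnorm_hsingle i (v : H i) : rnorm (hsingle v) = rnorm v.
Proof.
apply/eqP; rewrite -(@eqrXn2 _ 2) ?rnorm_ge0//; apply/eqP/EFin_inj.
rewrite sqrnormE (@esumr_single _ _ _ i) ?sqr_ge0 ?hsingle_in// => j ji.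
by rewrite hsingle_out// rnorm0 expr0n.
Qed.

Lemma hdot_hsingle x i (v : H i) : hdot x (hsingle v) = hdot (x i) v.
Proof.
rewrite hsum_hdotE (@csum_single _ _ _ i) ?hsingle_in// => j ji.
by rewrite hsingle_out// hdotC hdot0l rmorph0.
Qed.

Lemma hsingle_support i (v : H i) : Defs.finite_support (hsingle v).
Proof.
apply: sub_finite_set (finite_set1 i) => j /=.
by apply: contraNP => /eqP ji; apply/eqP; exact: hsingle_out.
Qed.

Lemma hsingleD i (v w : H i) : hsingle (v + w) = hsingle v + hsingle w.
Proof.
apply: hsum_ext => j; rewrite hsum_addE; have [->|ji] := eqVneq j i.
  by rewrite !hsingle_in.
by rewrite !hsingle_out// addr0.
Qed.

Lemma hsingleZ i (a : R[i]) (v : H i) : hsingle (a *: v) = a *: hsingle v.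
Proof.
apply: hsum_ext => j; rewrite hsum_scaleE; have [->|ji] := eqVneq j i.
  by rewrite !hsingle_in.
by rewrite !hsingle_out// scaler0.
Qed.

Lemma hsum_sumE (J : Type) (r : seq J) (P : pred J) (F : J -> V) i :
  (\sum_(j <- r | P j) F j) i = \sum_(j <- r | P j) F j i.
Proof.
by apply: (big_ind2 (fun (u : V) (v : H i) => u i = v)) => // u ? v ? <- <-.
Qed.

Lemma hrestrict_sum A x : finite_set A ->
  hrestrict A x = \sum_(i <- finmap.enum_fset (fset_set A)) hsingle (x i).
Proof.
move=> fA; apply: hsum_ext => j; rewrite hsum_sumE hrestrictE.
case: ifPn => jA.
  rewrite (bigD1_seq j) ?finmap.fset_uniq ?in_fset_set//=.
  rewrite hsingle_in big1_seq ?addr0// => i /andP[ij _].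
  by rewrite hsingle_out// eq_sym.
rewrite big1_seq// => i /andP[_]; rewrite in_fset_set// => iA.
by rewrite hsingle_out//; apply: contraNneq jA => ->.
Qed.

End hsum_facts.

(** * Block diagonal operators *)

Section block_op.
Variables (R : realType) (I : choiceType) (H : I -> hilbertType R).
Local Notation V := (hsum H).
Implicit Types (m : forall i, H i -> H i) (x y : V) (M : R).

(** Since both members of a pair already lie in the direct sum, the domain is the largest possible:
    all [x] whose blockwise image is again square summable. The same definition thus covers bounded
    and unbounded block operators. *)
Definition block_op m : operator V :=
  [set p : V * V | forall i, p.2 i = m i (p.1 i)].

Definition linear_blocks m :=
  forall i (a : R[i]) u v, m i (a *: u + v) = a *: m i u + m i v.

Definition bounded_blocks m M :=
  forall i v, rnorm (m i v) <= M * rnorm v.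

Lemma linear_blocks0 m i : linear_blocks m -> m i 0 = 0.
Proof.
by move=> lm; have := lm i (-1) 0 0; rewrite scaler0 addr0 scaleN1r addNr.
Qed.

Lemma linear_blocksB m i u v : linear_blocks m -> m i (u - v) = m i u - m i v.
Proof. by move=> lm; rewrite addrC -scaleN1r lm scaleN1r addrC. Qed.

Lemma block_opP m M x : bounded_blocks m M -> exists y, block_op m (x, y).
Proof.
move=> mM; have xM i : rnorm (m i (x i)) <= M * rnorm (x i) by exact: mM.
by have [y yE] := hsum_exists xM; exists y.
Qed.

Lemma block_op_linear m : linear_blocks m -> linear_op (block_op m).
Proof.
move=> lm; split=> [i|a p q mp mq i|x y z mxy mxz].
- by rewrite hsum_0E linear_blocks0.
- rewrite [LHS](_ : _ = a *: p.2 i + q.2 i)// mp mq -lm.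
  by congr (m i).
- by apply: hsum_ext => i; rewrite (mxy i) (mxz i).
Qed.

Lemma block_op_bounded m M : linear_blocks m -> 0 <= M -> bounded_blocks m M ->
  bounded_op (block_op m).
Proof.
move=> lm M0 mM; split; first exact: block_op_linear.
  by apply/seteqP; split=> // x _; exact: block_opP mM.
apply: (@le_lt_trans _ _ M%:E); last exact: ltry.
apply: op_normP => // p mp; apply: hsum_rnorm_le => // i.
by rewrite mp mM.
Qed.

(** Boundedness of the inner operator provides the intermediate vector, so the domains agree as
    well; the outer operator may be unbounded. *)
Lemma block_op_comp m m' M : bounded_blocks m' M ->
  op_comp (block_op m) (block_op m') = block_op (fun i v => m i (m' i v)).
Proof.
move=> mM; apply/seteqP; split=> [p [y m'y my] i|p mp].
  by rewrite my m'y.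
have [y my] := block_opP p.1 mM; exists y => // i.
by rewrite /= mp (my i).
Qed.

Lemma block_op_add m m' M : bounded_blocks m' M ->
  op_add (block_op m) (block_op m') = block_op (fun i v => m i v + m' i v).
Proof.
move=> mM; apply/seteqP; split=> [[u v] [y [z [/= my mz ->]]] i|p mp].
  by rewrite [LHS](hsum_addE y z i) (my i) (mz i).
have [z mz] := block_opP p.1 mM; exists (p.2 - z), z; split=> //.
  move=> i; rewrite [LHS](hsum_addE p.2 (- z) i) hsum_oppE mp (mz i).
  by rewrite addrK.


by rewrite subrK.
Qed.

Lemma block_op_scale m M (a : R[i]) : bounded_blocks m M ->
  op_scale a (block_op m) = block_op (fun i v => a *: m i v).
Proof.
move=> mM; apply/seteqP; split=> [[u v] [y /= my ->] i|p mp].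
  by rewrite [LHS](hsum_scaleE a y i) (my i).
have [z mz] := block_opP p.1 mM; exists z => //.
by apply: hsum_ext => i; rewrite hsum_scaleE mp (mz i).
Qed.

Lemma hdot_hsinglel i (v : H i) x : hdot (hsingle v) x = hdot v (x i).
Proof. by rewrite hdotC hdot_hsingle -hdotC. Qed.

(** Testing against vectors supported in a single block determines the adjoint coordinate by
    coordinate, so no bound uniform in the blocks is required. *)
Lemma block_op_adjoint m 

m' : linear_blocks m ->
  (forall i u v, hdot (m i u) v = hdot u (m' i v)) ->
  op_adjoint (block_op m) = block_op m'.
Proof.
move=> lm mm'; apply/seteqP; split=> [p ap i|p mp q mq].
  apply: hdot_inj => u; rewrite -mm'.
  rewrite -!hdot_hsinglel.
  apply/esym/(ap (hsingle u, hsingle (m i u))) => j /=.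
  have [->|ji] := eqVneq j i; first by rewrite !hsingle_in.
  by rewrite !hsingle_out// linear_blocks0.
rewrite !hsum_hdotE; congr csum; apply/funext => i.
by rewrite (mq i) (mp i) mm'.
Qed.



Lemma hsingleB i (v w : H i) : hsingle (v - w) = hsingle v - hsingle w.
Proof. by rewrite -scaleN1r hsingleD hsingleZ scaleN1r. Qed.

Lemma hrestrict_anti (A B : set I) x : A `<=` B ->
  rnorm (x - hrestrict B x) <= rnorm (x - hrestrict A x).
Proof.
move=> AB; rewrite -[leRHS]mul1r; apply: hsum_rnorm_le => // i.
rewrite mul1r !hrestrictC !hrestrictE !in_setC.
case: ifPn => iB; rewrite ?rnorm0 ?rnorm_ge0//.
rewrite ifT//; apply: contra iB => /set_mem/AB; exact: mem_set.
Qed.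

Lemma finite_support_dense : dense [set x : V | Defs.finite_support x].
Proof.
apply/rnorm_denseP => x e /(hrestrict_tail x)[A fA xA].
by exists (hrestrict A x) => //; exact: hrestrict_support.
Qed.

Lemma block_op_finite_support m x : linear_blocks m -> Defs.finite_support x ->
  exists y, block_op m (x, y).
Proof.
move=> lm fx.
exists (\sum_(i <- finmap.enum_fset (fset_set [set i | x i != 0]))
  hsingle (m i (x i))) => j /=; rewrite hsum_sumE.
have [xj|xj] := eqVneq (x j) 0.
  rewrite xj linear_blocks0// big1_seq// => i /andP[_].
  rewrite in_fset_set// inE /= => xi; rewrite hsingle_out//.
  by apply: contraNneq xi => <-; rewrite xj.
rewrite (bigD1_seq j) ?finmap.fset_uniq ?in_fset_set//=; last by rewrite inE.
rewrite hsingle_in big1_seq ?addr0// => i /andP[ij _].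
by rewrite hsingle_out// eq_sym.
Qed.

Lemma block_op_dense m : linear_blocks m -> dense (op_dom (block_op m)).
Proof.
move=> lm O On oO; have [x [Ox fx]] := finite_support_dense On oO.
by exists x; split=> //; exact: block_op_finite_support.
Qed.

(** Each block is continuous, so the relation passes to limits coordinatewise. Conversely, cutting
    [x] and [y] off on a common finite set keeps the relation and approximates both. The bound [K i]
    may grow with [i]. *)
Lemma block_op_closure m (K : I -> R) : linear_blocks m ->
  (forall i, 0 <= K i) -> (forall i v, rnorm (m i v) <= K i * rnorm v) ->
  closure [set p : V * V | Defs.finite_support p.1 /\
    forall i, p.2 i = m i (p.1 i)] = block_op m.
Proof.
move=> lm K0 mK; apply/seteqP; split=> [[x y] xy i|[x y] xy].
  apply/eqP; rewrite -subr_eq0; apply/eqP; apply: rnorm_eq0P => e e0 /=.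
  have d0 : 0 < e / (1 + K i) by rewrite divr_gt0// ltr_pwDl.
  have [p [[_ mp] xp yp]] := (rnorm_closure_pairP _ _ _).1 xy _ d0.
  have -> : y i - m i (x i) = (y i - p.2 i) + m i (p.1 i - x i).
    by rewrite linear_blocksB// mp subrKA.
  rewrite (le_trans (rnormD _ _))//.
  have -> : e = e / (1 + K i) + K i * (e / (1 + K i)).
    by field; rewrite gt_eqF// ltr_pwDl.
  apply: lerD; first by rewrite (le_trans (hsum_rnorm_coord (y - p.2) i))// ltW.
  rewrite (le_trans (mK _ _))// ler_wpM2l// rnormB.
  by rewrite (le_trans (hsum_rnorm_coord (x - p.1) i))// ltW.
apply/rnorm_closure_pairP => e e0.
have [A1 fA1 xA1] := hrestrict_tail x e0.
have [A2 fA2 yA2] := hrestrict_tail y e0.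
have fA : finite_set (A1 `|` A2) by rewrite finite_setU.
exists (hrestrict (A1 `|` A2) x, hrestrict (A1 `|` A2) y); split=> /=.
- split; first exact: hrestrict_support.
  move=> i; rewrite !hrestrictE; case: ifP => _; first exact: xy.
  by rewrite linear_blocks0.
- by apply: le_lt_trans xA1; apply: hrestrict_anti => i; left.
- by apply: le_lt_trans yA2; apply: hrestrict_anti => i; right.
Qed.

Lemma block_op_self_adjoint m : linear_blocks m ->
  (forall i u v, hdot (m i u) v = hdot u (m i v)) -> self_adjoint (block_op m).
Proof.
move=> lm mC; split; [exact: block_op_linear|exact: block_op_dense|].
exact: block_op_adjoint.
Qed.

Definition diag_op (a : I -> R) : operator V :=
  block_op (fun i v => (a i)%:C%C *: v).

Lemma diag_linear (a : I -> R) :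
  linear_blocks (fun i (v : H i) => (a i)%:C%C *: v).
Proof. by move=> i b u v; rewrite scalerDr !scalerA mulrC. Qed.

Lemma diag_bounded (a : I -> R) M : (forall i, `|a i| <= M) ->
  bounded_blocks (fun i (v : H i) => (a i)%:C%C *: v) M.
Proof. by move=> aM i v; rewrite rnormZr ler_wpM2r ?rnorm_ge0. Qed.

(** Compactness yields a cluster point of the [i]-th coordinates, and an ultrafilter converges to
    its cluster points. *)
Lemma ultra_compact_coord (F : set_system V) i M : UltraFilter F ->
  compact [set v : H i | rnorm v <= M] -> F [set x | rnorm x <= M] ->
  exists l : H i, forall e, 0 < e -> F [set x | rnorm (x i - l) < e].
Proof.
move=> FU cM FM.
have [] := cM ((fun x : V => x i) @ F).
  rewrite /nbhs/=; apply: filterS FM => x /=; apply: le_trans.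
  exact: hsum_rnorm_coord.
move=> l [_ cl]; exists l => e e0.
have [//|FN] := in_ultra_setVsetC [set x : V | rnorm (x i - l) < e] FU.
have [//|v /= [lv]] := cl [set v | ~ rnorm (v - l) < e] [set v | rnorm (l - v) < e] FN.
  by apply/rnorm_nbhsP; exists e.
by rewrite rnormB.
Qed.

(* An ultrafilter of images converges in each coordinate and the tails of its
   elements are uniformly small, so it is Cauchy. *)
Lemma diag_op_compact (a : I -> R) M : 0 <= M -> (forall i, `|a i| <= M) ->
  (forall e : R, 0 < e -> finite_set [set i | e <= `|a i|]) ->
  (forall i r, compact [set v : H i | rnorm v <= r]) ->
  compact_op (diag_op a).
Proof.
move=> M0 aM a0 cH; have lin := diag_linear a; have bnd := diag_bounded aM.
split; first exact: block_op_bounded bnd.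
rewrite precompactE compact_ultra; set S := [set _ | _ in _] => F FU FS.
have Fnear (e : R) (P : set V) : 0 < e ->
    (forall x s, S s -> rnorm (x - s) < e -> P x) -> F P.
  move=> e0 SP; apply: filterS FS => x /rnorm_closureP/(_ _ e0)[s Ss xs].
  exact: SP xs.
have SM s : S s -> rnorm s <= M.
  move=> [[x y] /= [xy x1] <-]; apply: (@le_trans _ _ (M * rnorm x)).
    by apply: hsum_rnorm_le => // i; rewrite (xy i) bnd.
  by rewrite ler_piMr.
have FM : F [set x | rnorm x <= M + 1].
  apply: (Fnear 1) => // x s /SM sM xs /=.
  by rewrite -[x](subrK s) (le_trans (rnormD _ _))// addrC lerD// ltW.
  have /(_ _)/cid lP i := ultra_compact_coord FU (cH i _) FM.
  pose l i : H i := sval (lP i).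
  have lF i : forall e, 0 < e -> F [set x | rnorm (x i - l i) < e].
    exact: svalP (lP i).
have Fsum (r : seq I) e : 0 < e ->
    F [set x | \sum_(i <- r) rnorm (x i - l i) < e].
  elim: r e => [|i r IH] e e0.
    by apply: filterS filterT => x _ /=; rewrite big_nil.
  have e20 : 0 < e / 2 by rewrite divr_gt0.
  apply: filterS2 (lF i _ e20) (IH _ e20) => x /= h1 h2.
  by rewrite big_cons [ltRHS]splitr ltrD.
have cF : cvg F.
  apply: cauchy_cvg; apply/cauchyP => _ /complex_gt0P[e e0 ->].
  have e40 : 0 < e / 4 by rewrite divr_gt0.
  have e20 : 0 < e / 2 by rewrite divr_gt0.
  (* Off the finite set [A] the coefficients are below e/4, so images of the unit ball have tails of
     norm at most e/4; passing to the closure costs another e/4. On [A] the convergence of finitely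
     many coordinates suffices. *)
  pose A := [set i | e / 4 <= `|a i|].
  have fA : finite_set A by exact: a0.
  pose s := finmap.enum_fset (fset_set A).
  exists (\sum_(i <- s) hsingle (l i)).
  have FA : F [set x | rnorm (x - hrestrict A x) < e / 2].
    apply: (Fnear (e / 4)) => // x _ [[u v] /= [uv u1] <-] xv.
    have -> : x - hrestrict A x = hrestrict (~` A) (x - v) + hrestrict (~` A) v.
      by rewrite hrestrictC hrestrictB subrK.
    rewrite (le_lt_trans (rnormD _ _))//.
    rewrite (_ : e / 2 = e / 4 + e / 4 * 1); last by field.
    apply: ltr_leD; first exact: le_lt_trans (hrestrict_le _ _) _.
    apply: (@le_trans _ _ (e / 4 * rnorm u)); last by rewrite ler_wpM2l// ltW.
    apply: hsum_rnorm_le => [|i]; first exact: ltW.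
    rewrite hrestrictE in_setC; case: ifPn => iA; last first.
      by rewrite rnorm0 mulr_ge0 ?rnorm_ge0// ltW.
    rewrite (uv i)/= rnormZr ler_wpM2r ?rnorm_ge0//.
    by rewrite leNgt; apply: contra iA => iA; rewrite inE /A/= ltW.
  apply: filterS2 (Fsum s _ e20) FA => x /= xl xA; apply/ball_rnorm.
  rewrite rnormB (le_lt_trans (rnorm_triangle (hrestrict A x) _ _))//.
  rewrite [ltRHS]splitr ltrD// hrestrict_sum// -sumrB.
  apply: le_lt_trans xl; rewrite (le_trans (rnorm_sum _ _ _))//.
  by apply: ler_sum => i _; rewrite -hsingleB rnorm_hsingle.
exists (lim F); split => //.
rewrite (closure_id (closure S)).1; last exact: closed_closure.
move=> B /cF FB; apply: (@filter_ex _ F).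
by apply: filterI => //; exact: FB.
Qed.

End block_op.

(** * The two-dimensional blocks *)

Lemma rnorm_ball_closed (R : realType) (V : normedModType R[i]) (r : R) :
  closed [set v : V | rnorm v <= r].
Proof.
move=> v /rnorm_closureP vr; apply/ler_addgt0Pr => e e0.
have [w /= wr vw] := vr _ e0; rewrite -[v](subrK w) addrC.
by rewrite (le_trans (rnormD _ _))// lerD// ltW.
Qed.


Lemma rnorm_continuous_pair (R : realType) (U : pseudoMetricNormedZmodType R)
    (W : normedModType R[i]) (f : U * U -> W) :
  (forall p q, rnorm (f p - f q) <= `|p.1 - q.1| + `|p.2 - q.2|) ->
  continuous f.
Proof.
move=> f1 p B /rnorm_nbhsP[e e0 eB].
have e20 : 0 < e / 2 by rewrite divr_gt0.
exists (ball p.1 (e / 2), ball p.2 (e / 2)).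
  by split; exact: nbhsx_ballx.
move=> q [/=]; rewrite -!ball_normE /= => h1 h2; apply: eB.
by rewrite (le_lt_trans (f1 _ _))// [ltRHS]splitr ltrD.
Qed.

Section complex_line_facts.
Variable R : realType.
Local Notation C := (complex_line R).

Lemma rnorm_complex_le (z : C) : rnorm z <= `|complex.Re z| + `|complex.Im z|.
Proof.
case: z => x y; rewrite -lecR -rnormE rmorphD /=.
have E : Complex x y = x%:C%C + 'i%C * y%:C%C by simpc.
rewrite [X in `|X|]E (le_trans (ler_normD _ _))// normrM.
by rewrite !normc_def/= !(expr0n, expr1n, add0r, addr0) !sqrtr_sqr sqrtr1 mul1r.
Qed.

Lemma complex_line_ball_compact (r : R) : compact [set z : C | rnorm z <= r].
Proof.
pose f (p : R * R) : C := Complex p.1 p.2.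
have cf : continuous f.
  apply: (@rnorm_continuous_pair R R^o) => p q.
  exact: rnorm_complex_le.
have K : compact (f @` (`[- r, r] `*` `[- r, r])).
  apply: continuous_compact; first exact: continuous_subspaceT.
  by apply: compact_setX; exact: segment_compact.
apply: (subclosed_compact (@rnorm_ball_closed R C r) K) => -[x y] xyr; exists (x, y) => //.
have : rnorm (Complex x y : C) = Num.sqrt (x ^+ 2 + y ^+ 2) by [].
move: xyr => /= + E; rewrite E => xyr.
split; rewrite /= in_itv/= -ler_norml (le_trans _ xyr)// -sqrtr_sqr.
  by rewrite ler_wsqrtr// lerDl sqr_ge0.
by rewrite ler_wsqrtr// lerDr sqr_ge0.


Qed.

End complex_line_facts.

Section two_dimensional.
Variable R : realType.
Local Notation C := (complex_line R).
Local Notation C2 := (hsum (fun _ : 'I_2 => complex_line R)).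
Implicit Types (u v : C2) (a b : C).

Lemma ord2P (i : 'I_2) : {i = 0} + {i = 1}.
Proof. by case: i => [[|[|//]] p]; [left|right]; exact: val_inj. Qed.

Lemma C2_ext u v : u 0 = v 0 -> u 1 = v 1 -> u = v.
Proof. by move=> h0 h1; apply: hsum_ext => i; case: (ord2P i) => ->. Qed.

Local Notation single2 i a := (@hsingle R 'I_2 (fun _ => C) i a).

Fact vec2_key a b : {v : C2 | v 0 = a /\ v 1 = b}.
Proof.
exists (single2 0 a + single2 1 b).
by split; rewrite hsum_addE hsingle_in hsingle_out// ?addr0 ?add0r.
Qed.

Definition vec2 a b : C2 := sval (vec2_key a b).

Lemma vec2_0 a b : vec2 a b 0 = a.
Proof. exact: (svalP (vec2_key a b)).1. Qed.

Lemma vec2_1 a b : vec2 a b 1 = b.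
Proof. exact: (svalP (vec2_key a b)).2. Qed.

Lemma vec2E a b : vec2 a b = single2 0 a + single2 1 b.
Proof.
by apply: C2_ext; rewrite ?vec2_0 ?vec2_1 hsum_addE hsingle_in hsingle_out//
  ?addr0 ?add0r.
Qed.

Lemma vec2K v : vec2 (v 0) (v 1) = v.
Proof. by apply: C2_ext; rewrite ?vec2_0 ?vec2_1. Qed.

Lemma vec2B a b a' b' : vec2 a b - vec2 a' b' = vec2 (a - a') (b - b').
Proof.
by apply: C2_ext; rewrite !(hsum_addE, hsum_oppE) !(vec2_0, vec2_1).
Qed.

Lemma hdot2E u v : hdot u v = hdot (u 0) (v 0) + hdot (u 1) (v 1).
Proof. by rewrite -[u in LHS]vec2K vec2E hdotDl !hdot_hsinglel. Qed.

Lemma sqrnorm2E v : rnorm v ^+ 2 = rnorm (v 0) ^+ 2 + rnorm (v 1) ^+ 2.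
Proof.
rewrite -!Re_hdotxx hdot2E.
by case: (hdot (v 0) _) (hdot (v 1) _) => [? ?] [? ?].
Qed.

Lemma rnorm_vec2_le a b : rnorm (vec2 a b) <= rnorm a + rnorm b.
Proof. by rewrite vec2E (le_trans (rnormD _ _))// !rnorm_hsingle. Qed.

Lemma C2_ball_compact (r : R) : compact [set v : C2 | rnorm v <= r].
Proof.
have cf : continuous (fun p : C * C => vec2 p.1 p.2).
  move=> p B /rnorm_nbhsP[e e0 eB].
  have e20 : 0 < e / 2 by rewrite divr_gt0.
  exists ([set a | rnorm (p.1 - a) < e / 2], [set b | rnorm (p.2 - b) < e / 2]).
    by split; apply/rnorm_nbhsP; exists (e / 2).
  move=> q [/= h1 h2]; apply: eB; rewrite vec2B.
  by rewrite (le_lt_trans (rnorm_vec2_le _ _))// [ltRHS]splitr ltrD.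
have K : compact ((fun p : C * C => vec2 p.1 p.2) @`
    ([set z | rnorm z <= r] `*` [set z | rnorm z <= r])).
  apply: continuous_compact; first exact: continuous_subspaceT.
  by apply: compact_setX; exact: complex_line_ball_compact.
apply: (subclosed_compact (@rnorm_ball_closed R C2 r) K) => v /= vr; exists (v 0, v 1); last exact: vec2K.
split; apply: le_trans vr; first exact: (hsum_rnorm_coord v 0).
exact: (hsum_rnorm_coord v 1).
Qed.

Definition swap2 (c : R) v : C2 := vec2 (c%:C%C *: v 1) (c%:C%C *: v 0).

Definition mul2 a b v : C2 := vec2 (a *: v 0) (b *: v 1).

Lemma swap2_linear (c : R) (z : R[i]) u v :
  swap2 c (z *: u + v) = z *: swap2 c u + swap2 c v.
Proof.
by apply: C2_ext; rewrite !(hsum_addE, hsum_scaleE, vec2_0, vec2_1)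
  scalerDr !scalerA [z * _]mulrC.
Qed.

Lemma mul2_linear a b (z : R[i]) u v :
  mul2 a b (z *: u + v) = z *: mul2 a b u + mul2 a b v.
Proof.
by apply: C2_ext; rewrite !(hsum_addE, hsum_scaleE, vec2_0, vec2_1)
  scalerDr !scalerA [z * _]mulrC.
Qed.





Lemma rnorm_swap2 (c : R) v : rnorm (swap2 c v) = `|c| * rnorm v.
Proof.
apply/eqP; rewrite -(@eqrXn2 _ 2) ?mulr_ge0 ?rnorm_ge0// exprMn !sqrnorm2E.
by rewrite vec2_0 vec2_1 !rnormZr !exprMn -mulrDr addrC.
Qed.

Lemma rnorm_mul2_le a b v (M : R) : rnorm a <= M -> rnorm b <= M ->
  rnorm (mul2 a b v) <= M * rnorm v.
Proof.
move=> aM bM; have M0 : 0 <= M by rewrite (le_trans _ aM)// rnorm_ge0.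
rewrite -ler_sqr ?nnegrE ?mulr_ge0 ?rnorm_ge0// exprMn !sqrnorm2E.
rewrite vec2_0 vec2_1 mulrDr !rnormZ !exprMn.
rewrite -/(rnorm a) -/(rnorm b).
by apply: lerD; rewrite ler_wpM2r ?sqr_ge0// ler_sqr ?nnegrE ?rnorm_ge0.


Qed.

Lemma hdot_swap2 (c : R) u v : hdot (swap2 c u) v = hdot u (swap2 c v).
Proof.
rewrite !hdot2E !vec2_0 !vec2_1 !hdotZl !hdotZr [RHS]addrC.
by rewrite conjCE /= !oppr0.
Qed.

Lemma hdot_mul2 a b u v :
  hdot (mul2 a b u) v = hdot u (mul2 (Num.conj (a : R[i])) (Num.conj (b : R[i])) v).
Proof. by rewrite !hdot2E !vec2_0 !vec2_1 !hdotZl !hdotZr !conjCK. Qed.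

Lemma swap2K (c c' : R) v : swap2 c (swap2 c' v) = (c * c')%:C%C *: v.
Proof.
by apply: C2_ext; rewrite hsum_scaleE !(vec2_0, vec2_1) scalerA -rmorphM.
Qed.

(** Factoring through the isometry [swap2 1] turns the off-diagonal commutator into a diagonal
    matrix, whose norm is read off its entries. *)
Lemma swap2_mul2_commutator (c : R) a b v :
  swap2 c (mul2 a b v) + (-1) *: mul2 a b (swap2 c v) =
  mul2 (c%:C%C * (b - a)) (c%:C%C * (a - b)) (swap2 1 v).
Proof.
apply: C2_ext; rewrite !(hsum_addE, hsum_scaleE, vec2_0, vec2_1) !scalerA mulr1.


  by rewrite -scalerDl; congr (_ *: _); ring.
by rewrite -scalerDl; congr (_ *: _); ring.
Qed.

End two_dimensional.

(** * Direct sums of two-point triples *)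

Lemma continuous_rnorm (R : realType) (T : topologicalType)
    (V : normedModType R[i]) (f : T -> V) :
  continuous f -> continuous (fun t => rnorm (f t)).
Proof.
move=> cf t; apply/cvgrPdist_lt => e e0.
have : nbhs t [set u | rnorm (f t - f u) < e].
  by apply: (cf t [set v | rnorm (f t - v) < e]); apply/rnorm_nbhsP; exists e.
apply: filterS => u /=; apply: le_lt_trans.
have rB (v w : V) : rnorm v - rnorm w <= rnorm (v - w).
  by rewrite lerBlDr (le_trans _ (rnormD _ _))// subrK.
by rewrite ler_norml lerNl opprB rB rnormB rB.
Qed.

Lemma continuous_rnorm_bounded (R : realType) (T : topologicalType)
    (V : normedModType R[i]) (f : T -> V) :
  compact [set: T] -> continuous f ->
  exists2 M : R, 0 <= M & forall t, rnorm (f t) <= M.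
Proof.
move=> cT /continuous_rnorm cf.
have [t0|nT] := pselect ([set: T] !=set0); last first.
  by exists 0 => // t; case: nT; exists t.
have [c _ cM] := compact_EVT_max t0 cT (continuous_subspaceT cf).


by exists (rnorm (f c)) => [|t]; [exact: rnorm_ge0|rewrite cM ?inE].
Qed.

Section pairs_triple.
Variables (R : realType) (T : metricType R) (J : set (T * T)).
Hypothesis T_compact : compact [set: T].
Hypothesis J_neq : forall p, J p -> p.1 <> p.2.
Local Notation C2 := (hsum (fun _ : 'I_2 => complex_line R)).
Local Notation V := (hsum (fun _ : J => C2)).
Local Notation block := (@block_op R J (fun _ => C2)).
Implicit Types (f g : T -> R[i]^o) (i : J) (p : V * V).

Definition pair_dist i : R := mdist (val i).1 (val i).2.
Local Notation d := pair_dist.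

Lemma pair_dist_gt0 i : 0 < d i.
Proof. by rewrite mdist_gt0; apply/eqP; apply: J_neq; exact: (set_valP i). Qed.

Definition dirac_block i : C2 -> C2 := swap2 (d i)^-1.

Definition rep_block f i : C2 -> C2 := mul2 (f (val i).1) (f (val i).2).

Lemma two_point_dirac i (q : C2 * C2) :
  Defs.dirac (two_point_triple (val i).1 (val i).2) q <-> q.2 = dirac_block i q.1.
Proof.
case: q => u v; split=> [[/= q0 q1]|/= ->].
  by apply: C2_ext; rewrite ?vec2_0 ?vec2_1.
by split; rewrite /= ?vec2_0 ?vec2_1.
Qed.

Lemma dirac_block_linear : linear_blocks dirac_block.
Proof. by move=> i a u v; exact: swap2_linear. Qed.

(** This removes the closure from the definition of the Dirac operator: membership in its graph
    becomes a condition on each block separately. *)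
Lemma pairs_diracE : Defs.dirac (pairs_triple J) = block dirac_block.
Proof.
rewrite -(@block_op_closure R J (fun _ => C2) dirac_block (fun i => `|(d i)^-1|))//.
- rewrite /pairs_triple/=; congr closure; apply/seteqP.
  split=> -[u v] /= [fu uv]; split=> // i.
    exact: ((two_point_dirac i (u i, v i)).1 (uv i)).
  exact: ((two_point_dirac i (u i, v i)).2 (uv i)).
- exact: dirac_block_linear.
- by move=> i v; rewrite rnorm_swap2.
Qed.

Lemma pairs_repE f : rep (pairs_triple J) f = block (rep_block f).
Proof.
rewrite [LHS](_ : _ = [set p : V * V | forall i,
  p.2 i 0 = (f (val i).1 : R[i]) *: p.1 i 0 /\
  p.2 i 1 = (f (val i).2 : R[i]) *: p.1 i 1])//.
apply/seteqP; split=> -[u v] uv i.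
  by have [u0 v0] := uv i; apply: C2_ext; rewrite ?vec2_0 ?vec2_1.
by split; have /= -> := uv i; rewrite ?vec2_0 ?vec2_1.
Qed.

Lemma pairs_coreE : core (pairs_triple J) = [set v : V | Defs.finite_support v].
Proof. by apply/seteqP; split=> v /= => [[]|]. Qed.

Lemma rep_block_linear f : linear_blocks (rep_block f).
Proof. by move=> i a u v; exact: mul2_linear. Qed.

Lemma rep_block_bounded f (M : R) : (forall t, rnorm (f t) <= M) ->
  bounded_blocks (rep_block f) M.
Proof. by move=> fM i v; exact: rnorm_mul2_le. Qed.

Lemma pairs_unital_representation : unital_representation (rep (pairs_triple J)).
Proof.
split.
- move=> f /(continuous_rnorm_bounded T_compact)[M M0 fM]; rewrite pairs_repE.
  exact: block_op_bounded (rep_block_linear f) M0 (rep_block_bounded fM).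
- rewrite pairs_repE; apply/seteqP; split=> -[u v] /=.
    move=> uv; apply: hsum_ext => i; rewrite (uv i).
    by apply: C2_ext; rewrite ?vec2_0 ?vec2_1 scale1r.
  move=> E i; have {E} -> : v = u := E.
  by apply: C2_ext; rewrite /= ?vec2_0 ?vec2_1 scale1r.
- move=> a f g /(continuous_rnorm_bounded T_compact)[M M0 fM].
  move=> /(continuous_rnorm_bounded T_compact)[N N0 gN].
  rewrite !pairs_repE (block_op_scale _ (rep_block_bounded fM)).
  rewrite (block_op_add _ (rep_block_bounded gN)); congr block.
  apply/funext => i; apply/funext => v; apply: C2_ext;
    by rewrite !(hsum_addE, hsum_scaleE, vec2_0, vec2_1) scalerDl scalerA.
- move=> f g _ /(continuous_rnorm_bounded T_compact)[N N0 gN].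
  rewrite !pairs_repE (block_op_comp _ (rep_block_bounded gN)); congr block.
  by apply/funext => i; apply/funext => v; apply: C2_ext;
    rewrite !(vec2_0, vec2_1) scalerA.
- move=> f _; rewrite !pairs_repE; apply/esym/block_op_adjoint.
    exact: rep_block_linear.
  by move=> i u v; exact: hdot_mul2.
Qed.

Lemma pairs_self_adjoint : self_adjoint (Defs.dirac (pairs_triple J)).
Proof.
rewrite pairs_diracE; apply: block_op_self_adjoint.
  exact: dirac_block_linear.
by move=> i u v; exact: hdot_swap2.
Qed.

Lemma pairs_commutators_defined : commutators_defined (pairs_triple J).
Proof.
split=> [|f cf].
  rewrite pairs_diracE pairs_coreE.
  rewrite -[RHS](@block_op_closure R J (fun _ => C2) dirac_block (fun i => `|(d i)^-1|))//.
  - by congr closure; apply/seteqP; split=> -[u v] /= [? ?].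
  - exact: dirac_block_linear.
  - by move=> i v; rewrite rnorm_swap2.
have [M M0 fM] := continuous_rnorm_bounded T_compact cf.
rewrite pairs_coreE /op_commutator pairs_diracE pairs_repE => u fu.
have [v uv] := block_opP u (rep_block_bounded fM).
have fv : Defs.finite_support v.
  apply: sub_finite_set fu => i /=; apply: contra_neq => ui.
  by rewrite (uv i)/= ui; apply: linear_blocks0; exact: rep_block_linear.
have [w vw] := block_op_finite_support dirac_block_linear fv.
have [v' uv'] := block_op_finite_support dirac_block_linear fu.
have [w' vw'] := block_opP v' (rep_block_bounded fM).
exists (w + (-1) *: w'), w, ((-1) *: w'); split=> //.
  by exists v.
by exists w' => //; exists v'.
Qed.

Lemma pairs_commutatorE f (u v : V) i :
  op_commutator (Defs.dirac (pairs_triple J)) (rep (pairs_triple J) f) (u, v) ->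
  v i = mul2 ((d i)^-1%:C%C * (f (val i).2 - f (val i).1))
             ((d i)^-1%:C%C * (f (val i).1 - f (val i).2)) (swap2 1 (u i)).
Proof.
rewrite pairs_diracE pairs_repE.
move=> [y [z [[s us sy] [z' [t ut tz'] /= zE] /= vE]]].
rewrite -swap2_mul2_commutator.
have -> : v i = y i + z i by have -> : v = y + z := vE.
have -> : z i = (-1) *: z' i by have -> : z = (-1) *: z' := zE.
by rewrite (sy i) (us i) (tz' i) (ut i).
Qed.

Lemma pairs_commutator_norm_le f (L : R) : continuous f -> 0 <= L ->
  (forall x y, J (x, y) -> rnorm (f x - f y) <= L * mdist x y) ->
  (commutator_norm (pairs_triple J) f <= L%:E)%E.
Proof.
move=> cf L0 fL; apply: op_normP => // -[u v] [uv _].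
apply: (@hsum_rnorm_le _ _ _ u v) => // i.
rewrite (pairs_commutatorE i uv).
have -> : rnorm (u i) = rnorm (swap2 1 (u i)) by rewrite rnorm_swap2 normr1 mul1r.
have d0 := pair_dist_gt0 i.
have fi : (d i)^-1 * rnorm (f (val i).1 - f (val i).2) <= L.
  rewrite mulrC ler_pdivrMr//; apply: fL.
  by rewrite -surjective_pairing; exact: (set_valP i).
have nZ (z : R[i]^o) : rnorm ((d i)^-1%:C%C * z : R[i]^o) = (d i)^-1 * rnorm z.
  by rewrite (rnormZr (d i)^-1 z) ger0_norm// invr_ge0 ltW.
by apply: rnorm_mul2_le; rewrite [leLHS]nZ// rnormB.
Qed.

(** The commutator is tested on the first unit vector of the block of [(x, y)]: one coordinate of
    the image is the difference quotient of [f] along that pair. *)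
Lemma pairs_commutator_norm_ge f (L : R) x y : continuous f -> 
  (commutator_norm (pairs_triple J) f <= L%:E)%E -> J (x, y) ->
  rnorm (f x - f y) <= L * mdist x y.
Proof.
move=> cf fL Jxy; pose i : J := exist _ (x, y) (mem_set Jxy).
have d0 : 0 < mdist x y := pair_dist_gt0 i.
pose u : V := @hsingle R J (fun _ => C2) i (vec2 1 0).
have cu : core (pairs_triple J) u by rewrite pairs_coreE; exact: hsingle_support.
have [v uv] := pairs_commutators_defined.2 f cf u cu.
have u1 : rnorm u = 1.
  rewrite rnorm_hsingle; apply/eqP; rewrite -(@eqrXn2 _ 2) ?rnorm_ge0//.
  rewrite sqrnorm2E vec2_0 vec2_1 rnorm0 expr0n addr0 expr1n.
  by rewrite /rnorm normr1 expr1n.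
have vL : rnorm (v : V) <= L.
  rewrite -lee_fin; apply: le_trans fL; apply: ereal_sup_ubound.
  by exists (u, v) => //; split => //=; rewrite u1.
have := le_trans (hsum_rnorm_coord (v i) 1) (le_trans (hsum_rnorm_coord (v : V) i) vL).
rewrite (pairs_commutatorE i uv) vec2_1 vec2_1 hsingle_in vec2_0 !scale1r.
rewrite [_ *: _]mulr1.
rewrite [leLHS](rnormZr (d i)^-1 (f x - f y)) ger0_norm ?invr_ge0 ?(ltW d0)//.
by rewrite mulrC ler_pdivrMr.
Qed.

(** On each block the square of the Dirac operator is the scalar d^-2, because the swap is an
    involution; this is the resulting eigenvalue of (I + D^2)^-1. *)
Definition resolvent_coef i : R := (1 + (d i)^-1 ^+ 2)^-1.

Lemma resolvent_coef_gt0 i : 0 < resolvent_coef i.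
Proof. by rewrite invr_gt0 ltr_pwDl// sqr_ge0. Qed.

Lemma resolvent_coef_le1 i : resolvent_coef i <= 1.
Proof. by rewrite invf_le1 ?lerDl ?sqr_ge0// ltr_pwDl// sqr_ge0. Qed.

Lemma resolvent_coef_le i : resolvent_coef i <= d i ^+ 2.
Proof.
rewrite -[leRHS]invrK -exprVn lef_pV2 ?posrE ?exprn_gt0 ?invr_gt0 ?pair_dist_gt0//.
  by rewrite lerDr.
by rewrite ltr_pwDl// sqr_ge0.
Qed.

(** Both 1 and d^-2 are at most r^-2, so 1 + d^-2 is at most 2 r^-2; the condition [r <= 1] is what
    controls the summand 1. *)
Lemma resolvent_coef_ge i (r : R) : 0 < r -> r <= 1 -> r <= d i ->
  r ^+ 2 / 2 <= resolvent_coef i.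
Proof.
move=> r0 r1 rd; have d0 := pair_dist_gt0 i.
rewrite -[leLHS]invrK lef_pV2 ?posrE ?invr_gt0 ?divr_gt0 ?exprn_gt0//; last first.
  by rewrite ltr_pwDl// sqr_ge0.
rewrite invf_div [2]mulr2n mulrDl !mul1r -exprVn lerD//.
  by rewrite exprn_ege1// invf_ge1.
by rewrite ler_sqr ?nnegrE ?invr_ge0 ?(ltW d0) ?(ltW r0)// lef_pV2.
Qed.



Lemma pairs_resolventE :
  resolvent (pairs_triple J) = @diag_op R J (fun _ => C2) resolvent_coef.
Proof.
rewrite /resolvent pairs_diracE.
have c1 i : 1 + (d i)^-1 ^+ 2 != 0 by rewrite gt_eqF// ltr_pwDl// sqr_ge0.
apply/seteqP; split=> -[u v] /= uv.
  move=> i; move: uv => [y [z [/= yv [t vt tz] /= uE]]].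
  have -> : u i = v i + z i by have -> : u = y + z := uE; have -> : y = v := yv.
  rewrite (tz i) /dirac_block (vt i) swap2K -[X in _ *: (X + _)]scale1r.
  by rewrite -scalerDl scalerA -expr2 -rmorphD -rmorphM mulVf// scale1r.
(* With c = 1/d, the bounds c^k / (1 + c^2) <= 1 for k <= 2 make D v and D^2 v square summable,
   which puts [v] in the domain of D^2. *)
have cb i (k : nat) : (k <= 2)%N -> (d i)^-1 ^+ k * resolvent_coef i <= 1.
  move=> k2; rewrite ler_pdivrMr ?ltr_pwDl ?sqr_ge0// mul1r.
  have := pair_dist_gt0 i; rewrite -invr_gt0; move: (d i)^-1 => c c0.
  by case: k k2 => [|[|[|//]]] _; rewrite ?expr0 ?expr1; nra.
have c0 i : 0 <= (d i)^-1 by rewrite invr_ge0 ltW// pair_dist_gt0.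
have a0 i := ltW (resolvent_coef_gt0 i).
have [t tE] : exists t : V, forall i, t i = dirac_block i (v i).
  apply: (@hsum_exists _ _ _ u _ 1) => i; rewrite rnorm_swap2 (uv i) rnormZr mulrA.
  rewrite ler_wpM2r ?rnorm_ge0// !ger0_norm//.
  by have := cb i 1%N isT; rewrite expr1.
have [z zE] : exists z : V, forall i, z i = dirac_block i (t i).
  apply: (@hsum_exists _ _ _ u _ 1) => i; rewrite rnorm_swap2 tE rnorm_swap2.
  rewrite (uv i) rnormZr !mulrA -expr2 ler_wpM2r ?rnorm_ge0// !ger0_norm//.
  exact: cb.
exists v, z; split=> //=; first by exists t.
apply: hsum_ext => i; rewrite hsum_addE zE tE /dirac_block swap2K -expr2.
rewrite -[X in X + _]scale1r -scalerDl (uv i)/= scalerA -rmorphD -rmorphM.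
by rewrite mulfV// scale1r.
Qed.

Lemma pairs_compact_resolvent :
  (forall e : R, 0 < e -> finite_set [set p | J p /\ e <= mdist p.1 p.2]) ->
  compact_op (resolvent (pairs_triple J)).
Proof.
move=> fJ; rewrite pairs_resolventE; apply: (@diag_op_compact _ _ _ _ 1) => //.
- by move=> i; rewrite ger0_norm ?resolvent_coef_le1// ltW// resolvent_coef_gt0.
- move=> e e0; have s0 : 0 < Num.sqrt e by rewrite sqrtr_gt0.
  have /(finite_preimage (f := val : J -> T * T)) := fJ _ s0.
  move=> /(_ (in2W val_inj)); apply: sub_finite_set => i /= ei.
  split; first exact: (set_valP i).
  have d0 := ltW (pair_dist_gt0 i).
  rewrite -ler_sqr ?nnegrE ?(ltW s0)// sqr_sqrtr ?(ltW e0)//.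


  rewrite (le_trans ei)// ger0_norm ?resolvent_coef_le// ltW//.
  exact: resolvent_coef_gt0.
- by move=> i r; exact: C2_ball_compact.
Qed.



End pairs_triple.

(** * Powers and traces of diagonal operators *)

Section complex_square.
Variable R : realType.
Implicit Types z w : R[i].

Definition sqn z : R := complex.Re z ^+ 2 + complex.Im z ^+ 2.

Lemma sqn_ge0 z : 0 <= sqn z.
Proof. by rewrite addr_ge0 ?sqr_ge0. Qed.

Lemma sqn_conj z : sqn (Num.conj z) = sqn z.
Proof. by rewrite conjCE; case: z => x y; rewrite /sqn/= sqrrN. Qed.

Lemma mul_conj_sqn z : z * Num.conj z = (sqn z)%:C%C.
Proof.
by rewrite conjCE; case: z => x y; rewrite /sqn; simpc; congr Complex => /=; ring.
Qed.

Lemma rnorm_complex_sqn z : rnorm (z : complex_line R) ^+ 2 = sqn z.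
Proof.
by rewrite (_ : rnorm _ = Num.sqrt (sqn z)) ?sqr_sqrtr ?sqn_ge0//; case: z.
Qed.

End complex_square.

(** * Bounded operators and best approximation along an orthonormal basis *)

Section orthonormal.
Variables (R : realType) (H : hilbertType R).
Implicit Types (E : set H) (A B : operator H) (x v : H) (r s : seq H).

Lemma linear_op_sum A (r : seq H) (c : H -> R[i]) (f : H -> H) : linear_op A ->
  (forall e, e \in r -> A (e, f e)) ->
  A (\sum_(e <- r) c e *: e, \sum_(e <- r) c e *: f e).
Proof.
move=> [A0 Al Af]; elim: r => [|e r IH] Ar; first by rewrite !big_nil.
rewrite !big_cons; apply: (Al _ (e, f e) (_, _)).
  by apply: Ar; rewrite mem_head.
by apply: IH => e' e'r; apply: Ar; rewrite inE e'r orbT.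
Qed.

Lemma bounded_op_bound A : bounded_op A ->
  exists2 M : R, 0 <= M & forall p, A p -> rnorm p.2 <= M * rnorm p.1.
Proof.
move=> [lA dA nA].
have n0 : (0 <= op_norm A)%E.
  apply: ereal_sup_ubound; exists (0, 0); rewrite /= ?rnorm0//.
  by split=> //; case: lA.
exists (fine (op_norm A)); first exact: fine_ge0.
move=> p; apply: op_norm_le => //.
by rewrite fineK// ge0_fin_numE.
Qed.

Lemma linear_opB A p q : linear_op A -> A p -> A q -> A (p - q).
Proof.
by move=> [_ Al _] Ap Aq; rewrite addrC -scaleN1r; exact: Al.
Qed.

(** Any [x] is close to some [u] in the span of [E], and by linearity both operators send [u] to the
    same vector, to which both images of [x] are then close. *)
Lemma bounded_op_sub E A B : orthonormal_basis E -> bounded_op A ->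
  bounded_op B -> (forall e, E e -> exists y, A (e, y) /\ B (e, y)) -> A `<=` B.
Proof.
move=> [_ _ /rnorm_denseP dE] bA bB AB [x y] Axy.
have [M M0 AM] := bounded_op_bound bA; have [N N0 BN] := bounded_op_bound bB.
have [lA _ _] := bA; have [lB dB _] := bB.
have [y' Bxy'] : op_dom B x by rewrite dB.
suff -> : y = y' by [].
apply/eqP; rewrite -subr_eq0; apply/eqP; apply: rnorm_eq0P => e e0.
have MN0 : 0 < M + N + 1 by rewrite ltr_wpDl// addr_ge0.
have [_ [r [c [rE ->]]] xu] := dE x _ (divr_gt0 e0 MN0).
have [f fP] : exists f : H -> H, forall e, e \in r -> A (e, f e) /\ B (e, f e).
  have /choice[f fP] : forall e, exists y, e \in r -> A (e, y) /\ B (e, y).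
    move=> e'; have [/rE/AB[z ABz]|_] := boolP (e' \in r); first by exists z.
    by exists 0.
  by exists f.
set u := \sum_(_ <- _) _ in xu.
pose w := \sum_(e <- r) c e *: f e.
have Auw : A (u, w) by apply: linear_op_sum => // e' /fP[].
have Buw : B (u, w) by apply: linear_op_sum => // e' /fP[].
have h1 := AM _ (linear_opB lA Axy Auw).
have h2 := BN _ (linear_opB lB Bxy' Buw).
rewrite (le_trans (rnorm_triangle w _ _))//.
rewrite [X in _ + X]rnormB.
apply: (@le_trans _ _ ((M + N + 1) * rnorm (x - u))).
  rewrite !mulrDl mul1r -[leLHS]addr0 lerD ?rnorm_ge0//.
  by rewrite lerD.
by rewrite -ler_pdivlMl// mulrC ltW.
Qed.

(* The projection on the span of [r] is the best approximation in that span. *)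
Lemma bessel_approx E v r s (c : H -> R[i]) : orthonormal_basis E ->
  uniq r -> [set` r] `<=` E -> {subset s <= r} ->
  rnorm v ^+ 2 - \sum_(e <- r) sqn (hdot v e) <=
  rnorm (v - \sum_(e <- s) c e *: e) ^+ 2.
Proof.
move=> [E1 Eo _] ur rE sr.
pose Pv := \sum_(e <- r) hdot v e *: e; pose w := v - Pv.
have we e : e \in r -> hdot w e = 0.
  move=> er; rewrite hdotC hdotBr hdot_sumr (bigD1_seq e)//= big1_seq.
    rewrite hdotZr (E1 _ (rE _ er)) mulr1 addr0 -hdotC subrr.
    by rewrite rmorph0.
  move=> e' /andP[e'e e'r].
  by rewrite hdotZr (Eo _ _ (rE _ er) (rE _ e'r)) ?mulr0 1?eq_sym.
have wspan t (b : H -> R[i]) : {subset t <= r} ->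
    hdot w (\sum_(e <- t) b e *: e) = 0.
  move=> tr; rewrite hdot_sumr big1_seq// => e /andP[_ /tr/we er].
  by rewrite hdotZr er mulr0.
set x := \sum_(e <- s) _.
have wxP : hdot w (x - Pv) = 0 by rewrite hdotBr !wspan ?subrr.
have -> : v - x = w - (x - Pv) by rewrite /w opprB addrA subrK.
have -> : rnorm v ^+ 2 - \sum_(e <- r) sqn (hdot v e) = rnorm w ^+ 2.
  rewrite -!Re_hdotxx; have -> : hdot w w = hdot w v.
    by rewrite {2}/w hdotBr wspan ?subr0.
  rewrite [hdot w v]hdotC /w hdotBr hdot_sumr rmorphB/= -hdotC.
  have -> : \sum_(i <- r) hdot v (hdot v i *: i) =
      (\sum_(e <- r) sqn (hdot v e))%:C%C.
    rewrite rmorph_sum/=; apply: eq_bigr => e _.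
    by rewrite hdotZr mulrC mul_conj_sqn.
  by rewrite conjCE; case: (hdot v v) => p q /=.
have := Re_hdot w (- (x - Pv)); rewrite rnormN -[X in hdot w X]scaleN1r hdotZr.
rewrite wxP mulr0 mul0rn => /esym/eqP; rewrite subr_eq add0r subr_eq => /eqP ->.
by rewrite addrC lerDl sqr_ge0.


Qed.

End orthonormal.

Section diag_power.
Variables (R : realType) (I : choiceType).
Local Notation C := (complex_line R).
Local Notation C2 := (hsum (fun _ : 'I_2 => C)).
Local Notation V := (hsum (fun _ : I => C2)).
Local Notation diag := (@diag_op R I (fun _ => C2)).
Variable a : I -> R.
Hypothesis a_gt0 : forall i, 0 < a i.
Hypothesis a_le1 : forall i, a i <= 1.
Implicit Types (E : set V) (B : operator V).

Definition unit_vec (k : I * 'I_2) : V :=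
  @hsingle R I (fun _ => C2) k.1 (@hsingle R 'I_2 (fun _ => C) k.2 (1 : R[i])).

Lemma hdot_unit_vec (x : V) k : hdot x (unit_vec k) = x k.1 k.2.
Proof.
rewrite !hdot_hsingle [LHS](_ : _ = (x k.1 k.2 : R[i]) * Num.conj (1 : R[i]))//.
by rewrite rmorph1 mulr1.
Qed.

Lemma unit_vecE k l : unit_vec k l.1 l.2 = (k == l)%:R.
Proof.
case: k l => [i j] [i' j']; rewrite /unit_vec/= xpair_eqE.
have [->|ii'] := eqVneq i i'; last by rewrite hsingle_out 1?eq_sym.
rewrite hsingle_in; have [->|jj'] := eqVneq j j'; first by rewrite hsingle_in.
by rewrite hsingle_out 1?eq_sym.
Qed.

Lemma unit_vec_inj : injective unit_vec.
Proof.
move=> k l kl; have := unit_vecE k l; rewrite kl unit_vecE eqxx.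
by case: eqP => // _ /eqP; rewrite oner_eq0.
Qed.

Lemma unit_vec_basis : orthonormal_basis (range unit_vec).
Proof.
split.
- by move=> _ [k _ <-]; rewrite hdot_unit_vec unit_vecE eqxx.
- move=> _ _ [k _ <-] [l _ <-] kl; rewrite hdot_unit_vec unit_vecE.
  suff /negbTE -> : k != l by [].
  by apply: contra_neq kl => ->.
apply/rnorm_denseP => x e /(hrestrict_tail x)[A fA xA].
exists (hrestrict A x) => //.
exists [seq unit_vec (i, j) | i <- finmap.enum_fset (fset_set A), j <- enum 'I_2].
exists (hdot x); split.
  by move=> v /= /allpairsP[p [_ _ ->]]; exists (p.1, p.2).
rewrite hrestrict_sum// big_allpairs_dep; apply: eq_bigr => i _.
apply: hsum_ext => i'; rewrite hsum_sumE; apply: hsum_ext => j'.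
rewrite hsum_sumE big_enum (bigD1 j')// big1 => [|j /andP[_ jj']].
  rewrite [RHS]addr0 !hsum_scaleE hdot_unit_vec/=.
  rewrite [X in _ *: X](unit_vecE (i, j') (i', j')) xpair_eqE eqxx andbT.
  have [->|ii'] := eqVneq i i'; first by rewrite hsingle_in [RHS]mulr1.
  by rewrite hsingle_out 1?eq_sym// [RHS]mulr0.
rewrite !hsum_scaleE [X in _ *: X](unit_vecE (i, j) (i', j')) xpair_eqE.
by rewrite (negbTE jj') andbF scaler0.
Qed.

Lemma diag_power_bounded (q : R) : 0 <= q -> bounded_op (diag (fun i => a i `^ q)).
Proof.
move=> q0; apply: (@block_op_bounded _ _ _ _ 1) => //; first exact: diag_linear.
apply: diag_bounded => i; rewrite ger0_norm ?powR_ge0//.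
rewrite [leRHS](_ : 1 = 1 `^ q); last by rewrite powR1.
by rewrite ge0_ler_powR ?nnegrE ?(ltW (a_gt0 i)).
Qed.

Lemma diag_bounded_op : bounded_op (diag a).
Proof.
apply: (@block_op_bounded _ _ _ _ 1) => //; first exact: diag_linear.
by apply: diag_bounded => i; rewrite ger0_norm// ltW.
Qed.

Lemma diag_unit_vec (b : I -> R) k : diag b (unit_vec k, (b k.1)%:C%C *: unit_vec k).
Proof.
move=> i; rewrite [LHS](hsum_scaleE (b k.1)%:C%C (unit_vec k) i) /=.
have [->//|ik] := eqVneq i k.1.
by rewrite /unit_vec hsingle_out// !scaler0.
Qed.

Lemma diag_power (q : R) : 0 <= q -> op_power (diag a) q (diag (fun i => a i `^ q)).
Proof.
move=> q0; split; [exact: diag_bounded_op|exact: diag_power_bounded|].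
exists (range unit_vec); first exact: unit_vec_basis.
move=> _ [k _ <-]; exists (a k.1).
by split; [exact: ltW|exact: diag_unit_vec|exact: (diag_unit_vec (fun i => a i `^ q))].
Qed.

Lemma diag_finite_trace (b : I -> R) : (forall i, 0 <= b i) ->
  (esumr b < +oo)%E -> finite_trace (diag b).
Proof.
move=> b0 bfin; exists (range unit_vec); first exact: unit_vec_basis.
rewrite /trace_along.
pose h (k : I * 'I_2) : V * V := (unit_vec k, (b k.1)%:C%C *: unit_vec k).
have hE k : (complex.Re (hdot (h k).2 (h k).1))%:E = (b k.1)%:E.
  rewrite [hdot _ _](hdotZl (b k.1)%:C%C (unit_vec k) (unit_vec k)).
  by rewrite hdot_unit_vec unit_vecE eqxx mulr1.


(* The trace sums over pairs of the graph lying above basis vectors; the graph being single-valued,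
   [h] is a bijection onto those pairs. *)
rewrite (@reindex_esum _ _ _ setT _ h).
- under eq_esum do rewrite hE.
  have -> : [set: I * 'I_2] = [set: I] `*`` (fun=> [set: 'I_2]).
    by apply/seteqP; split.
  rewrite -(@esum_esum _ _ _ setT (fun=> setT) (fun i _ => (b i)%:E)).
    (* Every block is two-dimensional and contributes [b i] twice. *)
    have -> : (fun i : I => (\esum_(j in [set: 'I_2]) (b i)%:E)%E) =
        (fun i => (2 * b i)%R%:E).
      apply/funext => i.
      rewrite esum_fset; [|exact: finite_finset|by rewrite lee_fin].
      rewrite (_ : [set: 'I_2] = [set 0] `|` [set 1]); last first.
        by apply/seteqP; split=> // j _; case: (ord2P j) => ->; [left|right].
      rewrite fsbigU//=; last by move=> j [/= -> /(congr1 val)].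
      by rewrite !fsbig_set1 -EFinD mulr_natl.
    rewrite -[X in (X < _)%E]/(esumr (fun i => 2 * b i)) esumrZ//.
    by rewrite lte_mul_pinfty.
  by move=> i j; rewrite lee_fin.
- split.
  + move=> k _; split; [exact: diag_unit_vec|by exists k].
  + by move=> k l _ _ [/unit_vec_inj].
  + move=> [w v] /= [bv [k _ /= kE]]; exists k => //; rewrite -{}kE in bv *.
    by congr (_, _); apply: hsum_ext => i; rewrite (bv i) (diag_unit_vec b k i).
Qed.

(* An eigenvector of [diag a] for [l] is supported where [a i = l], so [B] and
   the diagonal power agree on the basis of eigenvectors. *)
Lemma diag_power_unique (q : R) B : 0 <= q -> op_power (diag a) q B ->
  B `<=` diag (fun i => a i `^ q).
Proof.
move=> q0 [_ bB [E oE EB]]; apply: (bounded_op_sub oE bB (diag_power_bounded q0)).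
move=> e /EB[l [l0 Ae Be]]; exists ((l `^ q)%:C%C *: e); split=> // i /=.
have [->|ei] := eqVneq (e i) 0; first by rewrite !scaler0.
suff -> : l = a i by [].
apply/eqP; rewrite -subr_eq0; have := Ae i; rewrite /= => /eqP.
rewrite -subr_eq0 -scalerBl scaler_eq0 (negbTE ei) orbF -rmorphB.
by move=> /eqP/complexI ->.
Qed.

(* By Parseval the vectors [unit_vec (i, 0)] already account for [esumr b] in the
   trace along any basis; [1 / 2] leaves room for using finitely many vectors. *)
Lemma trace_diag_ge (b : I -> R) B E : (forall i, 0 <= b i) -> bounded_op B ->
  B `<=` diag b -> orthonormal_basis E -> (trace_along E B < +oo)%E ->
  (esumr b < +oo)%E.
Proof.
move=> b0 bB Bb oE tB.
have [M tM] : exists M : R, (trace_along E B <= M%:E)%E.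
  case: (trace_along E B) tB => // [r _|_]; first by exists r; rewrite lexx.
  by exists 0; rewrite leNye.


apply: (@le_lt_trans _ _ (2 * M)%:E); last exact: ltry.
apply: esumr_le => F fF; rewrite fsbig_finite//=.
set sF := finmap.enum_fset (fset_set F).
have [lE oo /rnorm_denseP dE] := oE.
have vP i : exists rc : seq V * (V -> R[i]), [set` rc.1] `<=` E /\
    rnorm (unit_vec (i, 0) - \sum_(e <- rc.1) rc.2 e *: e) < Num.sqrt (1 / 2).
  have [|_ [r [c [rE ->]]] h] := dE (unit_vec (i, 0)) (Num.sqrt (1 / 2)).


    by rewrite sqrtr_gt0.
  by exists (r, c).
have /choice[rc rcP] := vP.
(* One finite list of basis vectors approximates the unit vectors of all [i] in [F] at once;
   [bessel_approx] allows the list to be larger than the one used for a single [i]. *)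
pose r := undup (flatten [seq (rc i).1 | i <- sF]).
have rE : [set` r] `<=` E.
  move=> e /=; rewrite mem_undup => /flatten_mapP[i _]; exact: (rcP i).1.
have ur : uniq r by exact: undup_uniq.
have rnormu i : rnorm (unit_vec (i, 0)) ^+ 2 = 1.
  by rewrite -Re_hdotxx hdot_unit_vec unit_vecE eqxx.
have half i : i \in sF -> 1 / 2 <= \sum_(e <- r) sqn (e i 0).
  move=> iF; have := @bessel_approx _ _ E (unit_vec (i, 0)) r (rc i).1 (rc i).2 oE ur rE.
  have sr : {subset (rc i).1 <= r}.
    by move=> e ei; rewrite mem_undup; apply/flatten_mapP; exists i.
  move=> /(_ sr); rewrite rnormu.
  have -> : \sum_(e <- r) sqn (hdot (unit_vec (i, 0)) e) = \sum_(e <- r) sqn (e i 0).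
    by apply: eq_bigr => e _; rewrite hdotC hdot_unit_vec sqn_conj.
  have : rnorm (unit_vec (i, 0) - \sum_(e <- (rc i).1) (rc i).2 e *: e) ^+ 2 < 1 / 2.
    by rewrite -[ltRHS]sqr_sqrtr ?ltr_sqr ?nnegrE ?rnorm_ge0 ?sqrtr_ge0 ?(rcP i).2.
  by move: (_ ^+ 2) => t; lra.
have /choice[y By] : forall e, exists y, B (e, y).
  by move=> e; have [_ dB _] := bB; have : op_dom B e by rewrite dB.
(* The trace term of [e] is the sum of all [b i] times the squared norm of [e i]; dropping the
   blocks outside [F] and the second coordinates leaves a lower bound. *)
have ye (e : V) : \sum_(i <- sF) b i * sqn (e i 0) <= complex.Re (hdot (y e) e).
  have yeE i : hdot (y e i) (e i) = (b i * rnorm (e i) ^+ 2)%:C%C.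
    by rewrite (Bb _ (By e) i)/= hdotZl hdotxx rnormE -rmorphXn -rmorphM.
  have -> : hdot (y e) e = csum (fun i => (b i * rnorm (e i) ^+ 2)%:C%C).
    by rewrite hsum_hdotE; congr csum; apply/funext => i; exact: yeE.


  rewrite csum_ge0/= => [|i]; last by rewrite mulr_ge0 ?sqr_ge0.
  rewrite -lee_fin fineK; last first.
    rewrite ge0_fin_numE; last first.
      by apply: esumr_ge0 => i; rewrite mulr_ge0 ?sqr_ge0.
    apply: (@le_lt_trans _ _
      (esumr (fun i => rnorm (y e i) ^+ 2 + rnorm (e i) ^+ 2))).
      apply: le_esumr => i; rewrite -[leLHS]/(complex.Re (_%:C%C)) -yeE.
      by rewrite (le_trans (ler_norm _))// Re_hdot_le.
    rewrite esumrD; do ?[by move=> i; exact: sqr_ge0].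
    by rewrite -!sqrnormE -EFinD ltry.
  apply: le_trans (esumr_ge _ fF); rewrite fsbig_finite// lee_fin.
  apply: ler_sum => i _; rewrite ler_wpM2l//.
  by rewrite sqrnorm2E -!rnorm_complex_sqn lerDl sqr_ge0.
have : ((\sum_(e <- r) complex.Re (hdot (y e) e))%:E <= M%:E)%E.
  apply: le_trans tM; apply: esum_ge.
  exists [set` [seq (e, y e) | e <- r]].
    split; first exact: finite_seq.
    by move=> p /= /mapP[e er ->]; split=> //=; exact: rE.
  rewrite -fsbig_seq ?map_inj_uniq// => [|e e' [] //].
  by rewrite big_map sumEFin.
rewrite lee_fin => h.
suff : \sum_(i <- sF) b i / 2 <= M by rewrite -mulr_suml ler_pdivrMr// mulrC.
apply: le_trans h.
apply: (@le_trans _ _ (\sum_(e <- r) \sum_(i <- sF) b i * sqn (e i 0))); last first.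
  by apply: ler_sum => e _.
rewrite exchange_big/= big_seq [leRHS]big_seq; apply: ler_sum => i iF.
rewrite -mulr_sumr ler_wpM2l//.
by have := half i iF; rewrite div1r.
Qed.



End diag_power.

(** * Lipschitz functions and summability *)

Section lipschitz.
Variables (R : realType) (T : metricType R).

Lemma lipschitz_continuous (V : normedModType R[i]) (f : T -> V) (L : R) :
  (forall x y, rnorm (f x - f y) <= L * mdist x y) -> continuous f.
Proof.
move=> fL x B /rnorm_nbhsP[e e0 eB].
(* The shift by 1 keeps the divisor positive when [L] is zero, and the absolute value when it is
   negative. *)
have L1 : 0 < `|L| + 1 by rewrite ltr_wpDl.
apply/nbhs_ballP; exists (e / (`|L| + 1)) => /=; first exact: divr_gt0.
move=> y; rewrite ballEmdist /= ltr_pdivlMr// => xy; apply: eB.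
apply: le_lt_trans xy; rewrite (le_trans (fL x y))// mulrC ler_wpM2l ?mdist_ge0//.
by rewrite (le_trans (ler_norm L))// lerDl.
Qed.

Lemma real_continuous_pairP (h : T * T -> R) :
  (forall p e, 0 < e -> exists2 d, 0 < d & forall q, mdist p.1 q.1 < d ->
    mdist p.2 q.2 < d -> `|h p - h q| < e) -> continuous h.
Proof.
move=> hP p; apply/cvgrPdist_lt => e /(hP p)[d d0 dP].
exists (ball p.1 d, ball p.2 d); first by split; exact: nbhsx_ballx.
by move=> q [/=]; rewrite !ballEmdist /=; exact: dP.
Qed.

Lemma mdist_continuous_pair : continuous (fun p : T * T => mdist p.1 p.2).
Proof.
apply: real_continuous_pairP => p e e0; exists (e / 2); first exact: divr_gt0.
move=> q h1 h2; rewrite ltr_norml.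
have := metric_triangle q.1 p.1 q.2; have := metric_triangle p.1 p.2 q.2.
have := metric_triangle p.1 q.1 p.2; have := metric_triangle q.1 q.2 p.2.
rewrite [mdist q.1 p.1]metric_sym [mdist q.2 p.2]metric_sym.
by move=> *; apply/andP; split; lra.
Qed.

Lemma compact_pairT : compact [set: T] -> compact [set: T * T].
Proof.
move=> cT; have := compact_setX cT cT.
by rewrite (_ : _ `*` _ = setT)//; apply/seteqP; split.
Qed.

(* Where [h] varies by at least [e] the distance is bounded below by
   compactness. *)
Lemma continuous_lipschitz_upto (h : T -> R) (e : R) : compact [set: T] ->
  continuous h -> 0 < e ->
  exists2 L, 0 <= L & forall s t, h s <= h t + e + L * mdist s t.
Proof.
move=> cT ch e0.
pose D (p : T * T) := `|h p.1 - h p.2|.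
have cD : continuous D.
  move=> p; apply: cvg_norm; apply: cvgB.
    by apply: continuous_cvg; [exact: ch|exact: cvg_fst].
  by apply: continuous_cvg; [exact: ch|exact: cvg_snd].
pose K := [set p | e <= D p].
have [K0|K0] := pselect (K !=set0); last first.
  exists 0 => // s t; rewrite mul0r addr0 -lerBlDl leNgt; apply/negP => est.
  by apply: K0; exists (s, t); rewrite /K/= (le_trans (ltW est))// ler_norm.
have cK : compact K.
  apply: (subclosed_compact _ (compact_pairT cT)) => //.
  by apply: (closed_comp (D := [set x | e <= x])) => [p _|]; [exact: cD|exact: closed_ge].
have [p pK pmin] := compact_EVT_min K0 cK (continuous_subspaceT mdist_continuous_pair).
have [q qK qmax] := compact_EVT_max K0 cK (continuous_subspaceT cD).
have d0 : 0 < mdist p.1 p.2.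
  rewrite mdist_gt0; apply/negP => /eqP p12; move: pK; rewrite inE /K/= /D p12.
  by rewrite subrr normr0 leNgt e0.
have Dq0 : 0 <= D q by exact: normr_ge0.
exists (D q / mdist p.1 p.2); first by rewrite divr_ge0// ltW.
move=> s t; have [est|est] := leP (h s - h t) e.
  by rewrite -addrA -lerBlDl (le_trans est)// lerDl mulr_ge0 ?mdist_ge0 ?divr_ge0// ltW.
have Kst : (s, t) \in K by rewrite inE /K/= (le_trans (ltW est))// ler_norm.
have h1 := qmax _ Kst; have h2 := pmin _ Kst.
rewrite -addrA -lerBlDl (le_trans (ler_norm _))// (le_trans h1)//.
rewrite -[leLHS]add0r lerD ?(ltW e0)// mulrAC ler_pdivlMr//.
by rewrite ler_wpM2l.
Qed.

(* Inf-convolution: [g] is the largest [L]-Lipschitz minorant of [h]. *)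
Lemma real_lipschitz_approx (h : T -> R) (e : R) : compact [set: T] ->
  continuous h -> 0 < e -> exists2 L, 0 <= L & exists g : T -> R,
    (forall s t, `|g s - g t| <= L * mdist s t) /\
    (forall t, `|h t - g t| <= e).
Proof.
move=> cT ch e0; have [L L0 hL] := continuous_lipschitz_upto cT ch e0.
exists L => //; pose S t := [set h s + L * mdist s t | s in setT].
have Slb t : lbound (S t) (h t - e).
  move=> _ [s _ <-]; have := hL t s; rewrite metric_sym.
  by move: (L * _) => w; lra.
have Sn t : S t !=set0 by exists (h t + L * mdist t t); exists t.
have Sinf t s : inf (S t) <= h s + L * mdist s t.
  by apply: ge_inf; [exists (h t - e); exact: Slb|exists s].
exists (fun t => inf (S t)); split=> [|t].
  have le_g s t : inf (S s) - inf (S t) <= L * mdist s t.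
    rewrite lerBlDr addrC -lerBlDr; apply: lb_le_inf => // _ [u _ <-].
    rewrite lerBlDr (le_trans (Sinf s u))// -addrA lerD2l -mulrDr ler_wpM2l//.
    by rewrite (le_trans (metric_triangle u t s))// [mdist s t]metric_sym.
  move=> s t; rewrite ler_norml le_g andbT lerNl opprB (le_trans (le_g t s))//.
  by rewrite metric_sym.
have h1 : inf (S t) <= h t by rewrite (le_trans (Sinf t t))// mdistxx mulr0 addr0.
have h2 : h t - e <= inf (S t) by exact: lb_le_inf.
by rewrite ger0_norm ?subr_ge0//; move: h1 h2; lra.
Qed.

Lemma complex_lipschitz_approx (f : T -> R[i]^o) (e : R) : compact [set: T] ->
  continuous f -> 0 < e -> exists2 L, 0 <= L & exists g : T -> R[i]^o,
    (forall s t, rnorm (g s - g t) <= L * mdist s t) /\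
    (forall t, rnorm (f t - g t) <= e).
Proof.
move=> cT cf e0; have e20 : 0 < e / 2 by rewrite divr_gt0.
have cRe (p : R[i]^o -> R) : (forall z w, `|p z - p w| <= rnorm (z - w)) ->
    continuous (p \o f).
  move=> p1 t; apply/cvgrPdist_lt => d d0.
  have : nbhs t [set u | rnorm (f t - f u) < d].
    by apply: (cf t [set v | rnorm (f t - v) < d]); apply/rnorm_nbhsP; exists d.
  by apply: filterS => u /=; exact: le_lt_trans.
have Re1 (z w : R[i]^o) : `|complex.Re z - complex.Re w| <= rnorm (z - w).
  case: z w => [a b] [a' b'].
  rewrite (_ : rnorm _ = Num.sqrt ((a - a') ^+ 2 + (b - b') ^+ 2))//= -sqrtr_sqr.
  by rewrite ler_wsqrtr// lerDl sqr_ge0.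
have Im1 (z w : R[i]^o) : `|complex.Im z - complex.Im w| <= rnorm (z - w).
  case: z w => [a b] [a' b'].
  rewrite (_ : rnorm _ = Num.sqrt ((a - a') ^+ 2 + (b - b') ^+ 2))//= -sqrtr_sqr.
  by rewrite ler_wsqrtr// lerDr sqr_ge0.
have [L L0 [g [gL fg]]] := real_lipschitz_approx cT (cRe _ Re1) e20.
have [M M0 [k [kM fk]]] := real_lipschitz_approx cT (cRe _ Im1) e20.
exists (L + M); first exact: addr_ge0.
exists (fun t => Complex (g t) (k t)); split=> [s t|t].
  rewrite (le_trans (rnorm_complex_le _))// mulrDl; exact: lerD (gL s t) (kM s t).
rewrite (le_trans (rnorm_complex_le _))// [leRHS]splitr.
have -> : f t - Complex (g t) (k t) =
    Complex (complex.Re (f t) - g t) (complex.Im (f t) - k t) by case: (f t).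
by rewrite lerD//=; [exact: fg|exact: fk].
Qed.

End lipschitz.

Lemma sumr_const_size (R : pzRingType) (I : Type) (r : seq I) (x : R) :
  \sum_(i <- r) x = (size r)%:R * x.
Proof. by rewrite big_const_seq count_predT iter_addr_0 mulr_natl. Qed.

(** * Spectral triple axioms and summability in terms of the lengths of the pairs *)

Section pairs_spectral_triple.


Variables (R : realType) (T : metricType R) (J : set (T * T)).
Hypothesis T_compact : compact [set: T].
Hypothesis J_neq : forall p, J p -> p.1 <> p.2.
Local Notation C2 := (hsum (fun _ : 'I_2 => complex_line R)).

(** Lipschitz functions are uniformly dense and have finite commutator norm for every [J]. The
    finiteness condition serves the compactness of the resolvent: its eigenvalues then tend to
    zero. *)
Lemma pairs_spectral_triple :
  (forall e : R, 0 < e -> finite_set [set p | J p /\ e <= mdist p.1 p.2]) ->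
  spectral_triple (pairs_triple J).
Proof.
move=> fJ; split.
- exact: pairs_unital_representation.
- exact: pairs_self_adjoint.
- exact: pairs_commutators_defined.
- move=> f e cf e0; have [L L0 [g [gL fg]]] := complex_lipschitz_approx T_compact cf e0.
  have cg : continuous g := lipschitz_continuous gL.
  exists g; split=> //; apply: (@le_lt_trans _ _ L%:E); last exact: ltry.
  by apply: pairs_commutator_norm_le => // x y _.
- exact: pairs_compact_resolvent.
Qed.

Lemma pairs_p_summable (s : R) : 0 <= s ->
  (esumr (fun i : J => pair_dist i `^ s)%R < +oo)%E -> p_summable (pairs_triple J) s.
Proof.
move=> s0 ds; have s20 : 0 <= s / 2 by rewrite divr_ge0.
exists (@diag_op R J (fun _ => C2) (fun i => resolvent_coef i `^ (s / 2))).
  rewrite pairs_resolventE//; apply: diag_power => //; [exact: resolvent_coef_gt0|].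
  exact: resolvent_coef_le1.
apply: diag_finite_trace => [i|]; first exact: powR_ge0.
apply: le_lt_trans ds; apply: le_esumr => i.
have d0 := pair_dist_gt0 J_neq i.
apply: (@le_trans _ _ ((pair_dist i ^+ 2) `^ (s / 2))).
  rewrite ge0_ler_powR ?nnegrE ?sqr_ge0 ?(ltW (resolvent_coef_gt0 i))//.
  exact: resolvent_coef_le.
rewrite -(powR_mulrn _ (ltW d0)) -powRrM.
by rewrite (_ : 2 * (s / 2) = s)//; field.
Qed.

(** Markov's inequality: a pair of length at least [r] contributes at least (r^2 / 2)^(s/2) to the
    trace, so [K] is 2^(s/2) times the sum of the diagonal entries. That sum is finite by
    [diag_power_unique] and [trace_diag_ge], whatever power and basis witness summability. *)
Lemma p_summable_count (s : R) : 0 <= s -> p_summable (pairs_triple J) s ->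
  exists K : R, forall (r : R) (l : seq (T * T)), 0 < r -> r <= 1 -> uniq l ->
    (forall p, p \in l -> J p /\ r <= mdist p.1 p.2) ->
    (size l)%:R * r `^ s <= K.
Proof.
move=> s0 [B opB [E oE tB]]; have s20 : 0 <= s / 2 by rewrite divr_ge0.
rewrite pairs_resolventE// in opB.
have bB : bounded_op B by case: opB.
have a0 := @resolvent_coef_gt0 R T J; have

 a1 := @resolvent_coef_le1 R T J.
have BD := diag_power_unique a0 a1 s20 opB.
have := trace_diag_ge (fun i => powR_ge0 _ _) bB BD oE tB.
set b := fun i => _; move=> bfin.
have b0 i : 0 <= b i by exact: powR_ge0.
exists (2 `^ (s / 2) * fine (esumr b)) => r l r0 r1 ul lJ.
pose li : seq J := pmap insub l.
have lil i : i \in li -> val i \in l by rewrite mem_pmap_sub.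
have uli : uniq li by exact: pmap_sub_uniq.
have -> : size l = size li.
  rewrite size_pmap_sub; apply/esym/eqP; rewrite -all_count.
  by apply/allP => p /lJ[Jp _]; exact: mem_set.
have -> : r `^ s = 2 `^ (s / 2) * (r ^+ 2 / 2) `^ (s / 2).
  rewrite -powRM ?divr_ge0 ?sqr_ge0// mulrC mulfVK ?pnatr_eq0//.
  by rewrite -(powR_mulrn _ (ltW r0)) -powRrM; congr (_ `^ _); field.
rewrite mulrCA ler_wpM2l ?powR_ge0//.
rewrite -lee_fin fineK ?ge0_fin_numE ?esumr_ge0//.
apply: le_trans (esumr_ge b (finite_seq li)).
rewrite -fsbig_seq// lee_fin -sumr_const_size.
rewrite big_seq [leRHS]big_seq; apply: ler_sum => i /lil il.
have [_ ri] := lJ _ il.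
rewrite ge0_ler_powR ?nnegrE ?divr_ge0 ?sqr_ge0 ?(ltW (a0 i))//.
exact: (resolvent_coef_ge J_neq r0 r1 ri).
Qed.







End pairs_spectral_triple.

(** * Nets and covering numbers *)

Section covering.
Variables (R : realType) (T : metricType R).
Implicit Types (r : R) (c F : seq T).

Definition is_cover r c := forall t, exists2 x, x \in c & mdist x t <= r.

Definition separated_points r F :=
  forall x y, x \in F -> y \in F -> x != y -> r < mdist x y.

(** Otherwise the complements of finite unions of balls generate a proper filter, and a cluster
    point of it would have to avoid the ball around itself. *)
Lemma finite_cover r : compact [set: T] -> 0 < r -> exists c, is_cover r c.
Proof.
move=> cT r0; apply: contrapT => nc.
pose B c := [set t | forall x, x \in c -> r < mdist x t].
have FB : Filter (filter_from [set: seq T] B).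
  apply: filter_fromT_filter => [|c1 c2]; first by exists [::].
  exists (c1 ++ c2) => t Bt.
  by split=> x xc; apply: Bt; rewrite mem_cat xc ?orbT.
have PB : ProperFilter (filter_from [set: seq T] B).
  apply: filter_from_proper => c _; apply: contrapT => Bc0; apply: nc.
  exists c => t; apply: contrapT => ct; apply: Bc0; exists t => x xc.
  by rewrite ltNge; apply/negP => xt; apply: ct; exists x.
have [p [_ clp]] := cT _ PB (filterT : filter_from [set: seq T] B setT).
have [||t [pt]] := clp [set t | r < mdist p t] (ball p r).
- by exists [:: p] => // t; apply; rewrite mem_head.
- exact: nbhsx_ballx.
- by rewrite ballEmdist /= => tp; move: (lt_trans pt tp); rewrite ltxx.
Qed.

(** Sending each point of [F] to a centre within r/2 is injective: two points with a common centre
    are at distance at most [r]. *)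
Lemma separated_size r F c : uniq F -> separated_points r F ->
  is_cover (r / 2) c -> (size F <= size c)%N.
Proof.
move=> uF sF cc.
have /choice[f fP] : forall t, exists x, x \in c /\ mdist x t <= r / 2.
  by move=> t; have [x xc xt] := cc t; exists x.
have finj : {in F &, injective f}.
  move=> x y xF yF fxy; apply: contrapT => /eqP/(sF x y xF yF).
  apply/negP; rewrite -leNgt (le_trans (metric_triangle x (f x) y))//.
  rewrite [leRHS]splitr lerD//; first by rewrite metric_sym (fP x).2.
  by rewrite fxy (fP y).2.
rewrite -(size_map f); apply: uniq_leq_size; first by rewrite map_inj_in_uniq.
by move=> _ /mapP[x _ ->]; exact: (fP x).1.
Qed.

(** Sizes of separated sets are bounded by that of an r/2-cover, so a largest one exists; a point it
    fails to cover could be added to it. *)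
Lemma maximal_net r : compact [set: T] -> 0 < r ->
  exists F, [/\ uniq F, separated_points r F & is_cover r F].
Proof.
move=> cT r0; have [c cc] := finite_cover cT (divr_gt0 r0 (ltr0Sn R 1)).
pose P n := `[< exists F, [/\ uniq F, separated_points r F & size F = n] >].
have P0 : exists n, P n by exists 0%N; apply/asboolP; exists [::].
have Pc n : P n -> (n <= size c)%N.
  by move=> /asboolP[F [uF sF <-]]; exact: separated_size cc.
case: (ex_maxnP P0 Pc) => n /asboolP[F [uF sF Fn]] nmax.
exists F; split=> // t; apply: contrapT => Ft.
have tF x : x \in F -> r < mdist x t.
  by move=> xF; rewrite ltNge; apply/negP => xt; apply: Ft; exists x.
suff /nmax : P n.+1 by rewrite ltnn.
apply/asboolP; exists (t :: F); split=> /=; last by rewrite Fn.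
  rewrite uF andbT; apply/negP => /tF; rewrite mdistxx ltNge.
  by rewrite (ltW r0).
move=> x y; rewrite !inE => /predU1P[->|xF] /predU1P[->|yF]; rewrite ?eqxx//.
- by move=> _; rewrite metric_sym; exact: tF.
- by move=> _; exact: tF.
- exact: sF.
Qed.

Lemma covering_number_le r c : is_cover r c -> covering_number T r <= (size c)%:R.
Proof.
move=> cc; apply: ge_inf; last by exists (size c) => //; exists c.
by exists 0 => _ [n _ <-]; exact: ler0n.
Qed.

(** Compactness supplies at least one finite cover, so that the real [inf] is a genuine infimum and
    not the default value at the empty set. *)
Lemma covering_number_ge r (m : R) : compact [set: T] -> 0 < r ->
  (forall c, is_cover r c -> m <= (size c)%:R) -> m <= covering_number T r.
Proof.
move=> cT r0 mc; apply: lb_le_inf.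
  by have [c cc] := finite_cover cT r0; exists (size c)%:R, (size c) => //; exists c.
by move=> _ [_ [c <- cc] <-]; exact: mc.
Qed.

Lemma covering_number_anti r r' : compact [set: T] -> 0 < r -> r <= r' ->
  covering_number T r' <= covering_number T r.
Proof.
move=> cT r0 rr'; apply: covering_number_ge => // c cc.
apply: covering_number_le => t; have [x xc xt] := cc t.
by exists x => //; exact: le_trans rr'.
Qed.

Lemma covering_number_ge1 r : [set: T] !=set0 -> compact [set: T] -> 0 < r ->
  1 <= covering_number T r.
Proof.
move=> [t _] cT r0; apply: covering_number_ge => // c cc.
by have [x] := cc t; case: c {cc} => // y c _ _; rewrite ler1n.
Qed.

Lemma covering_number_separated r F : compact [set: T] -> 0 < r -> uniq F ->
  separated_points r F -> (size F)%:R <= covering_number T (r / 2).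
Proof.
move=> cT r0 uF sF; apply: covering_number_ge; rewrite ?divr_gt0// => c cc.
by rewrite ler_nat; exact: separated_size cc.
Qed.

Lemma closed_mdist_ball (x : T) r : closed [set t | mdist x t <= r].


Proof.
move=> t xt; apply/ler_addgt0Pr => e e0.
have [|u [/= xu]] := xt (ball t e); first exact: nbhsx_ballx.
rewrite ballEmdist /= metric_sym => ut.
by rewrite (le_trans (metric_triangle x u t))// lerD// ltW.
Qed.

(* Otherwise the ball around [x] and the union of the other balls would
   disconnect the space. *)
Lemma connected_neighbour r F x y : connected [set: T] -> 0 <= r ->
  is_cover r F -> x \in F -> y \in F -> y != x ->
  exists z, [/\ z \in F, z != x & mdist x z <= 2 * r].
Proof.
move=> conT r0 cF xF yF yx; apply: contrapT => nz.
pose B := [set t | mdist x t <= r].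
pose D := \bigcup_(z in [set z | z \in F /\ z != x]) [set t | mdist z t <= r].
have cD : closed D.
  apply: closed_bigcup => [|z _]; last exact: closed_mdist_ball.
  by apply: sub_finite_set (finite_seq F) => z [].
have BD : B = ~` D.
  apply/seteqP; split=> t; rewrite /B/=.
    move=> xt [z [zF zx] /= zt]; apply: nz; exists z; split=> //.
    rewrite (le_trans (metric_triangle x t z))// mulr_natl mulr2n lerD//.
    by rewrite metric_sym.
  move=> nD; have [z zF zt] := cF t; have [<-//|zx] := eqVneq z x.
  by case: nD; exists z.
have BT : B = setT.
  apply: conT; first by exists x; rewrite /B/= mdistxx.
    by exists B; rewrite ?setTI// BD openC.
  by exists B; rewrite ?setTI//; exact: closed_mdist_ball.
have : B y by rewrite BT.
by rewrite BD; apply; exists y => //=; rewrite mdistxx.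
Qed.

End covering.

(** * Dyadic radii and the upper Minkowski dimension *)

Section dimension.
Variables (R : realType) (T : metricType R).
Hypothesis T_neq0 : [set: T] !=set0.
Hypothesis T_compact : compact [set: T].
Local Notation N := (covering_number T).

Definition radius n : R := 2^-1 ^+ n.

Lemma radius_gt0 n : 0 < radius n.
Proof. by rewrite exprn_gt0// invr_gt0. Qed.

Lemma radius_le1 n : radius n <= 1.
Proof. by rewrite exprn_ile1 ?invr_ge0// invf_le1// ler1n. Qed.

Lemma radiusS n : radius n.+1 = radius n / 2.
Proof. by rewrite /radius exprSr. Qed.

Lemma radius_lt (x : R) : 0 < x -> exists n, radius n < x.
Proof.
move=> x0; exists (Num.bound x^-1).
rewrite /radius exprVn invf_plt ?posrE ?exprn_gt0//.
apply: (lt_trans (archi_boundP _)); first by rewrite invr_ge0 ltW.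
by rewrite -natrX ltr_nat ltn_expl.
Qed.

Lemma radius_bracket (x : R) : 0 < x -> x <= 1 ->
  exists n, radius n.+1 <= x <= radius n.
Proof.
move=> x0 x1; have ex : exists n, radius n.+1 <= x.
  have [n nx] := radius_lt x0; exists n; rewrite (le_trans _ (ltW nx))//.
  by rewrite radiusS ler_pdivrMr// ler_peMr ?ler1n// ltW// radius_gt0.
case: (ex_minnP ex) => n nx nmin; exists n; rewrite nx/= leNgt; apply/negP.
case: n nx nmin => [|n] nx nmin; first by rewrite /radius expr0 ltNge x1.
by move=> /ltW /nmin; rewrite ltnn.
Qed.

Lemma upper_minkowski_dim_le (s K : R) : 0 < s ->
  (forall n, N (radius n) * radius n `^ s <= K) ->
  (upper_minkowski_dim T <= s%:E)%E.
Proof.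
move=> s0 NK; apply/lee_addgt0Pr => e e0.
have K0 : 0 < K.
  apply: lt_le_trans (NK 0%N); rewrite mulr_gt0 ?powR_gt0 ?radius_gt0//.
  by apply: lt_le_trans (covering_number_ge1 _ _ _); rewrite ?radius_gt0.
(* Passing from dyadic to arbitrary radii costs at most a factor 2 in the radius, hence the additive
   term [s * ln 2]. *)
have NK' (r : R) : 0 < r -> r <= 1 -> ln (N r) <= ln K + s * ln 2 + s * - ln r.
  move=> r0 r1; have [n /andP[nr rn]] := radius_bracket r0 r1.
  have N0 x : 0 < x -> 0 < N x.
    by move=> x0; apply: lt_le_trans (covering_number_ge1 _ _ _).
  have h : N r * (r / 2) `^ s <= K.
    apply: le_trans (NK n.+1); apply: ler_pM; rewrite ?powR_ge0 ?(ltW (N0 _ r0))//.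
      by apply: covering_number_anti; rewrite ?radius_gt0.
    apply: ge0_ler_powR; rewrite ?nnegrE ?divr_ge0 ?(ltW s0) ?(ltW r0)//.
      by rewrite ltW ?radius_gt0.
    by rewrite radiusS ler_wpM2r.


  move: h; rewrite -ler_ln ?posrE ?mulr_gt0 ?powR_gt0 ?divr_gt0 ?N0//.
  rewrite lnM ?posrE ?powR_gt0 ?divr_gt0 ?N0// ln_powR ln_div ?posrE//.
  by move: (ln (N r)) (ln K) (ln 2) (ln r) => a b c d; lra.
pose A := `|ln K + s * ln 2| + 1.
have A0 : 0 < A by rewrite ltr_wpDl.
(* Below [eta] one has - ln r > A / e, so the additive constant is at most e times - ln r and
   disappears into [e] after division. *)
pose eta := expR (- (A / e)).
have eta1 : eta <= 1 by rewrite -expR0 ler_expR oppr_le0 divr_ge0// ltW.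
apply: (@le_trans _ _ (ereal_sup
    [set (ln (N r) / - ln r)%:E | r in [set r | 0 < r /\ r < eta]])).
  apply: ereal_inf_lbound; exists [set r | 0 < r /\ r < eta] => //.
  apply: filterI; first exact: nbhs_right_gt.
  by apply: nbhs_right_lt; exact: expR_gt0.
apply: ge_ereal_sup => _ [r [r0 reta] <-]; rewrite -EFinD lee_fin.
have lr : A / e < - ln r.
  by rewrite ltrNr -[ltRHS]expRK ltr_ln ?posrE ?expR_gt0.
have lr0 : 0 < - ln r by apply: lt_trans lr; rewrite divr_gt0.
rewrite ler_pdivrMr// (le_trans (NK' r r0 _)) ?(ltW (lt_le_trans reta _))//.
rewrite mulrDl addrC lerD2l; move: lr; rewrite ltr_pdivrMr// mulrC => /ltW.
by apply: le_trans; rewrite /A (le_trans (ler_norm _))// lerDl.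
Qed.

Lemma upper_minkowski_dim_lt (s : R) : (upper_minkowski_dim T < s%:E)%E ->
  exists2 r0 : R, 0 < r0 & forall r, 0 < r -> r < r0 -> N r <= r `^ (- s).
Proof.
move=> /ereal_inf_lt[_ [V V0 <-] Vs].
have [r0 /= r00 rV] : exists2 r0 : R, 0 < r0 & forall r, 0 < r -> r < r0 -> V r.
  move: V0 => /nbhs_ballP[r0 /= r00 rV]; exists r0 => // r r_gt0 rr0.
  by apply: rV => //; rewrite /ball/= sub0r normrN gtr0_norm.
(* The bound 1 makes - ln r positive, which is needed to clear the denominator. *)
exists (Num.min r0 1); first by rewrite lt_min r00 ltr01.
move=> r r_gt0; rewrite lt_min => /andP[rr0 r1].
have lr0 : 0 < - ln r by rewrite oppr_gt0 ln_lt0// r_gt0.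
have : ((ln (N r) / - ln r)%:E <= s%:E)%E.
  apply: le_trans (ltW Vs); apply: ereal_sup_ubound; exists r => //.
  exact: rV.
have N0 : 0 < N r by apply: lt_le_trans (covering_number_ge1 _ _ _).
rewrite lee_fin ler_pdivrMr// mulrN -mulNr -ln_powR ler_ln// posrE//.
exact: powR_gt0.
Qed.

End dimension.

(** * The pairs attached to a sequence of nets *)

Section net_pairs.
Variables (R : realType) (T : metricType R).
Hypothesis T_compact : compact [set: T].
Variables (F : nat -> seq T) (C : R) (choose : set T -> T).
Local Notation rho := (radius R).
Hypothesis F_cover : forall n, is_cover (rho n) (F n).
Hypothesis C_ge2 : 2 <= C.
Hypothesis chooseP : forall A : set T, A !=set0 -> A (choose A).

Definition level_points n := F n ++ F n.+1.

(** A pair is listed in both orders, possibly repeatedly, and at every level where it qualifies;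
    this is harmless because only upper bounds on the size of the list are used. *)
Definition level_pairs n : seq (T * T) :=
  [seq p <- [seq (x, y) | x <- level_points n, y <- level_points n] |
    (p.1 != p.2) && (mdist p.1 p.2 <= C * rho n)].

(* [choose] orients each pair. *)
Definition net_pairs : set (T * T) :=
  [set p | (exists n, p \in level_pairs n) /\ p.1 = choose [set p.1; p.2]].
Local Notation J := net_pairs.

Lemma level_pairsP n x y : reflect
  [/\ x \in level_points n, y \in level_points n, x != y &
      mdist x y <= C * rho n]
  ((x, y) \in level_pairs n).
Proof.
rewrite mem_filter; apply: (iffP andP) => /=.
  move=> [/andP[xy xyC] /allpairsP[[u v] /= [un vn [xu yv]]]].
  by split=> //; rewrite ?xu ?yv.
by move=> [xn yn xy xyC]; rewrite xy xyC; split=> //; exact: allpairs_f.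
Qed.



Lemma net_pairs_neq p : J p -> p.1 <> p.2.
Proof. by case: p => x y [[n /level_pairsP[_ _ /eqP]]]. Qed.

(** [choose] sees only the set of the two endpoints, so if both orders were in [J] the two first
    components would coincide. *)
Lemma net_pairs_unordered : unordered_pairs J.
Proof.
move=> p Jp; split; first exact: net_pairs_neq.
move=> [_ /= p2]; have [_ p1] := Jp; apply: (net_pairs_neq Jp).
by rewrite [LHS]p1 [RHS]p2 setUC.
Qed.

Lemma net_pairs_sub : J `<=` \bigcup_n [set` level_pairs n].
Proof. by move=> p [[n pn] _]; exists n. Qed.

Lemma net_pairs_countable : countable J.
Proof.
apply: (sub_countable (subset_card_le net_pairs_sub)).
apply: bigcup_countable => // n _.
exact/finite_set_countable/finite_seq.
Qed.

(** Pairs of level n have length at most C 2^-n, so length at least [e] occurs only at the finitely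
    many levels below [m]. *)
Lemma net_pairs_finite (e : R) : 0 < e ->
  finite_set [set p | J p /\ e <= mdist p.1 p.2].
Proof.
move=> e0; have C0 : 0 < C by apply: lt_le_trans C_ge2.
have [m me] := radius_lt (divr_gt0 e0 C0).
apply: (@sub_finite_set _ _ (\bigcup_(n in `I_m) [set` level_pairs n])).
  move=> [x y] /= [[[n xyn] _] exy]; exists n => //=.
  rewrite ltnNge; apply/negP => mn; have /level_pairsP[_ _ _ xyC] := xyn.
  move: (le_trans exy xyC); rewrite leNgt => /negP; apply.
  rewrite mulrC -ltr_pdivlMr//; apply: le_lt_trans me.
  by rewrite /radius ler_wiXn2l ?invr_ge0 ?invf_le1 ?ler1n.
by apply: bigcup_finite => // n _; exact: finite_seq.
Qed.

Lemma net_pairs_mem n x y : x \in level_points n -> y \in level_points n ->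
  x != y -> mdist x y <= C * rho n -> J (x, y) \/ J (y, x).
Proof.
move=> xn yn xy xyC.
have [|] : [set x; y] (choose [set x; y]) by apply: chooseP; exists x; left.
  move=> /esym xc; left; split=> //; exists n; exact/level_pairsP.
move=> /esym yc; right; split; last by rewrite /= setUC.
by exists n; apply/level_pairsP; split=> //; rewrite 1?eq_sym 1?metric_sym.
Qed.

Lemma pairs_lipschitz (f : T -> R[i]^o) n x y :
  (forall x y, J (x, y) -> rnorm (f x - f y) <= mdist x y) ->
  x \in level_points n -> y \in level_points n -> mdist x y <= C * rho n ->
  rnorm (f x - f y) <= mdist x y.
Proof.
move=> fJ xn yn xyC; have [->|xy] := eqVneq x y.
  by rewrite subrr rnorm0 mdist_ge0.
have [/fJ//|/fJ] := net_pairs_mem xn yn xy xyC.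
by rewrite rnormB metric_sym.
Qed.

Lemma level_pointsl n x : x \in F n -> x \in level_points n.
Proof. by rewrite mem_cat => ->. Qed.

Lemma level_pointsr n x : x \in F n.+1 -> x \in level_points n.
Proof. by rewrite mem_cat orbC => ->. Qed.

(* Walk from the net point near [t] at level [n] to [t] through nearby net
   points of the successive levels. *)
Lemma net_path_le (f : T -> R[i]^o) n t x : continuous f ->
  (forall x y, J (x, y) -> rnorm (f x - f y) <= mdist x y) ->
  x \in F n -> mdist x t <= rho n -> rnorm (f x - f t) <= 3 * rho n.
Proof.
move=> cf fJ xn xt.
have /choice[a aP] : forall k, exists y, y \in F k /\ mdist y t <= rho k.
  by move=> k; have [y yk yt] := F_cover k t; exists y.
(* As the radii halve, [3 * (rho k - rho k.+1)] is exactly rho k + rho k.+1, written in a form that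
   telescopes along the chain. This length is below 2 rho k, so [C_ge2] makes the step a pair of
   level k. *)
have step k y z : y \in F k -> mdist y t <= rho k -> z \in F k.+1 ->
    mdist z t <= rho k.+1 -> rnorm (f y - f z) <= 3 * (rho k - rho k.+1).
  move=> yk yt zk zt.
  have yz : mdist y z <= rho k + rho k.+1.
    by rewrite (le_trans (metric_triangle y t z))// lerD// metric_sym.
  have r0 := radius_gt0 R k; rewrite radiusS in yz *.
  apply: (@le_trans _ _ (mdist y z)); last by move: yz; lra.
  apply: (@pairs_lipschitz f k) => //; [exact: level_pointsl|exact: level_pointsr|].
  apply: (le_trans yz); apply: (@le_trans _ _ (2 * rho k)); first by lra.
  by rewrite ler_wpM2r// ltW.
have chain k : exists y, [/\ y \in F (n + k)%N, mdist y t <= rho (n + k)%N &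
    rnorm (f x - f y) <= 3 * (rho n - rho (n + k)%N)].
  elim: k => [|k [y [yk yt fy]]].
    by exists x; rewrite addn0 !subrr rnorm0 mulr0.
  rewrite addnS; exists (a (n + k).+1); have [ak akt] := aP (n + k).+1.
  split=> //; rewrite (le_trans (rnorm_triangle (f y) _ _))//.
  by have := step _ _ _ yk yt ak akt; move: fy; rewrite !mulrBr; lra.
(* The chain only approaches [t]; continuity of [f] bridges the remaining gap up to [e]. *)
apply/ler_addgt0Pr => e e0.
have : nbhs t [set u | rnorm (f t - f u) < e].
  by apply: (cf t [set v | rnorm (f t - v) < e]); apply/rnorm_nbhsP; exists e.
move=> /nbhs_ballP[d /= d0 de]; have [m md] := radius_lt d0.
have [y [ym yt fy]] := chain m.
have ty : rnorm (f y - f t) < e.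
  rewrite rnormB; apply: de; rewrite ballEmdist /= metric_sym (le_lt_trans yt)//.
  apply: le_lt_trans md; rewrite /radius exprD ler_piMl ?exprn_ge0 ?invr_ge0//.
  exact: radius_le1.
rewrite (le_trans (rnorm_triangle (f y) _ _))//.
have := radius_gt0 R (n + m); move: fy ty; rewrite mulrBr.
by lra.
Qed.

(** The distance from [s] is 1-Lipschitz on all of the space, hence admissible for any [J], and it
    separates [s] and [t] by exactly their distance. *)
Lemma net_pairs_dist_ge s t : ((mdist s t)%:E <= induced_dist (pairs_triple J) s t)%E.
Proof.
pose f (u : T) : R[i]^o := (mdist s u)%:C%C.
have f1 x y : rnorm (f x - f y) <= 1 * mdist x y.
  rewrite -rmorphB mul1r.
  have -> (r : R) : rnorm (r%:C%C : R[i]^o) = `|r|.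
    by rewrite -[r%:C%C]mulr1 (rnormZr r (1 : R[i]^o)) /rnorm normr1 mulr1.
  have := metric_triangle s x y; have := metric_triangle s y x.
  by rewrite [mdist y x]metric_sym ler_norml => *; apply/andP; split; lra.
have cf : continuous f := lipschitz_continuous f1.
apply: ereal_sup_ubound; exists f.
  split=> //; apply: pairs_commutator_norm_le => //; first exact: net_pairs_neq.
congr EFin; rewrite /f mdistxx sub0r rnormN.
by rewrite -[_%:C%C]mulr1 (rnormZr _ (1 : R[i]^o)) /rnorm normr1 mulr1 ger0_norm ?mdist_ge0.
Qed.

Lemma net_pairs_dist_le (delta : R) s t : 0 < delta ->
  (forall x y : T, mdist x y + 2 + 16 / delta <= C) ->
  (induced_dist (pairs_triple J) s t <= ((1 + delta) * mdist s t)%:E)%E.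
Proof.
move=> delta0 TC; apply: ge_ereal_sup => _ [f [cf f1] <-]; rewrite lee_fin.
have fJ x y : J (x, y) -> rnorm (f x - f y) <= mdist x y.
  move=> Jxy; rewrite -[leRHS]mul1r.
  exact: (pairs_commutator_norm_ge T_compact net_pairs_neq cf f1 Jxy).
have [->|st] := eqVneq s t; first by rewrite subrr rnorm0 mdistxx mulr0.
have D0 : 0 < mdist s t by rewrite mdist_gt0.
(* The constant 8 is the total error in units of [rho n]: 3 for each of the two chains and 2 for
   replacing [s] and [t] by net points. *)
have ex : exists n, 8 * rho n <= delta * mdist s t.
  have [|n nD] := @radius_lt R (delta * mdist s t / 8); first by rewrite divr_gt0// mulr_gt0.
  by exists n; rewrite mulrC -ler_pdivlMr// ltW.
case: (ex_minnP ex) => n nD nmin.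
have [x xn xs] := F_cover n s; have [y yn yt] := F_cover n t.
have r0 := radius_gt0 R n.
have xy : mdist x y <= mdist s t + 2 * rho n.
  have := metric_triangle x s y; have := metric_triangle s t y.
  by move: xs yt; rewrite [mdist y t]metric_sym; lra.
(* The net points must form a pair of level n. At n = 0 this is why [C] exceeds the diameter plus 2;
   at later levels minimality of n bounds d(s, t) by (16 / delta) times [rho n]. *)
have DC : mdist s t + 2 * rho n <= C * rho n.
  case: n nD nmin {xn xs yn yt xy r0} => [_ _|n nD nmin].
    have := TC s t; have : 0 < 16 / delta by rewrite divr_gt0.
    by rewrite /radius expr0; lra.
  have : 8 * rho n > delta * mdist s t.
    by rewrite ltNge; apply/negP => /nmin; rewrite ltnn.
  have := radius_gt0 R n; rewrite radiusS => r0 h.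
  have h' : mdist s t <= 16 / delta * (rho n / 2).
    rewrite mulrAC ler_pdivlMr// mulrC (le_trans (ltW h))//; lra.
  apply: (@le_trans _ _ ((16 / delta + 2) * (rho n / 2))); first by rewrite [leRHS]mulrDl lerD.




  rewrite ler_wpM2r ?divr_ge0 ?(ltW r0)//.
  by have := TC s s; rewrite mdistxx; lra.
have h1 := net_path_le cf fJ xn xs; have h2 := net_path_le cf fJ yn yt.
have h3 := pairs_lipschitz fJ (level_pointsl xn) (level_pointsl yn) (le_trans xy DC).
have := rnorm_triangle (f x) (f s) (f t); have := rnorm_triangle (f y) (f x) (f t).
rewrite rnormB in h1; rewrite mulrDl mul1r.
by move: h1 h2 h3 xy nD; lra.
Qed.

End net_pairs.

(** * Counting pairs level by level: summability and dimension *)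

Lemma geometric_bound (R : realType) (u : nat -> R) (n0 : nat) (A q : R) :
  (forall n, 0 <= u n) -> 0 <= A -> 0 <= q -> q < 1 ->
  (forall n, (n0 <= n)%N -> u n <= A * q ^+ n) ->
  exists M, forall m, \sum_(n < m) u n <= M.
Proof.
move=> u0 A0 q0 q1 uA; pose U := \sum_(n < n0) u n; pose B := A / (1 - q).
have q1' : 0 < 1 - q by rewrite subr_gt0.
(* [U] absorbs the terms before [n0], and [B] is A times the full geometric series; the factor 1 -
   q^k is the closed form of its partial sums. *)
have h k : \sum_(n < n0 + k) u n <= U + B * (1 - q ^+ k).
  elim: k => [|k IH]; first by rewrite addn0 subrr mulr0 addr0.
  rewrite addnS big_ord_recr/= (le_trans (lerD IH (uA _ (leq_addr _ _))))//.
  rewrite -addrA lerD2l.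
  have -> : B * (1 - q ^+ k.+1) = B * (1 - q ^+ k) + A * q ^+ k.
    by rewrite /B exprS; field; rewrite gt_eqF.
  rewrite lerD2l ler_wpM2l// exprD ler_piMl ?exprn_ge0//.
  by rewrite exprn_ile1// ltW.
exists (U + B) => m; apply: (@le_trans _ _ (\sum_(n < n0 + m) u n)).
  rewrite addnC big_split_ord/= lerDl; exact: sumr_ge0.
rewrite (le_trans (h m))// lerD2l ler_piMr ?divr_ge0 ?(ltW q1')//.
by rewrite gerBl exprn_ge0.
Qed.

Section net_pairs_dimension.
Variables (R : realType) (T : metricType R).
Hypothesis T_neq0 : [set: T] !=set0.
Hypothesis T_compact : compact [set: T].
Variables (F : nat -> seq T) (C : R) (choose : set T -> T).
Local Notation rho := (radius R).
Hypothesis F_uniq : forall n, uniq (F n).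
Hypothesis F_sep : forall n, separated_points (rho n) (F n).
Hypothesis F_cover : forall n, is_cover (rho n) (F n).
Hypothesis C_ge2 : 2 <= C.
Hypothesis chooseP : forall A : set T, A !=set0 -> A (choose A).

Local Notation J := (net_pairs F C choose).
Local Notation N := (covering_number T).

(** Each net point selects a pair of [J] containing it. A pair has two endpoints and so is selected
    by at most two points. Separation bounds its length from below, and [C_ge2] admits the neighbour
    found by connectedness. *)
Lemma connected_net_pairs n : connected [set: T] -> (1 < size (F n))%N ->
  exists l : seq (T * T), [/\ uniq l,
    forall p, p \in l -> J p /\ rho n <= mdist p.1 p.2 &
    (size (F n) <= 2 * size l)%N].
Proof.
move=> conT Fn.
have /choice[f fP] : forall x, exists p, x \in F n ->
    [/\ J p, rho n <= mdist p.1 p.2 & (x == p.1) || (x == p.2)].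
  move=> x; have [xn|] := boolP (x \in F n); last by exists (x, x).
  have [y yn yx] : exists2 y, y \in F n & y != x.
    have /hasP[y yn yx] : has (predC1 x) (F n).
      rewrite has_predC; apply/negP => /all_pred1P Fx.
      have := F_uniq n; rewrite Fx; case: (size _) Fn => [|[|m]] //= _.
      by rewrite inE eqxx.
    by exists y.
  have [|z [zn zx xz]] := connected_neighbour conT _ (F_cover n) xn yn yx.
    exact/ltW/radius_gt0.
  have xzC : mdist x z <= C * rho n.
    by rewrite (le_trans xz)// ler_wpM2r// ltW// radius_gt0.
  have xz' : x != z by rewrite eq_sym.
  have rxz := ltW (F_sep xn zn xz').
  have [Jp|Jp] := net_pairs_mem chooseP (level_pointsl xn) (level_pointsl zn) xz' xzC.
    by exists (x, z) => _; split=> //=; rewrite eqxx.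
  by exists (z, x) => _; split=> //=; rewrite ?eqxx ?orbT// metric_sym.
exists (undup (map f (F n))); split; first exact: undup_uniq.
  by move=> p; rewrite mem_undup => /mapP[x /fP[Jp rp _] ->].
set l := undup _; rewrite mul2n -addnn.
rewrite -[X in (_ <= X + _)%N](size_map fst) -[X in (_ <= _ + X)%N](size_map snd).
rewrite -size_cat; apply: uniq_leq_size => // x xn.
have [_ _ xf] := fP x xn; have fl : f x \in l by rewrite mem_undup map_f.
rewrite mem_cat; case/orP: xf => /eqP ->; first by rewrite map_f.
by rewrite orbC map_f.
Qed.

Lemma net_pairs_dim_le (s : R) : 0 < s -> p_summable (pairs_triple J) s ->
  connected [set: T] -> (upper_minkowski_dim T <= s%:E)%E.
Proof.
move=> s0 sJ conT.
have [K KP] := p_summable_count (@net_pairs_neq _ _ F C choose) (ltW s0) sJ.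
(* The alternative 1 covers the levels whose net has at most one point, where no neighbour
   exists. *)
apply: (@upper_minkowski_dim_le _ _ T_neq0 T_compact s (Num.max (2 * K) 1)) => // n.
have r0 := radius_gt0 R n; have r1 := radius_le1 R n.
have NF : N (rho n) * rho n `^ s <= (size (F n))%:R * rho n `^ s.
  by rewrite ler_wpM2r ?powR_ge0// covering_number_le.
rewrite (le_trans NF)// le_max; apply/orP.
have [Fn|Fn] := leqP (size (F n)) 1.
  right; rewrite -[leRHS]mul1r; apply: ler_pM; rewrite ?ler0n ?powR_ge0//.
    by rewrite -[leRHS]/(1%:R) ler_nat.
  rewrite [leRHS](_ : 1 = 1 `^ s); last by rewrite powR1.
  by rewrite ge0_ler_powR ?nnegrE ?(ltW r0) ?(ltW s0).
left; have [l [ul lJ Fl]] := connected_net_pairs conT Fn.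
apply: (@le_trans _ _ ((2 * size l)%:R * rho n `^ s)).
  by rewrite ler_wpM2r ?powR_ge0// ler_nat.
by rewrite natrM -mulrA ler_wpM2l// KP.
Qed.

(** The finer net of the level is separated at scale [rho n.+1], and comparing a separated set with
    a cover halves the radius once more, whence [rho n.+2]. The factor 2 accounts for the two
    nets. *)
Lemma size_level_pairs n :
  (size (level_pairs F C n))%:R <= (2 * N (rho n.+2)) ^+ 2.
Proof.
have FN m : (size (F m))%:R <= N (rho m.+1).
  by rewrite radiusS; apply: covering_number_separated; rewrite ?radius_gt0.
have h1 : (size (F n))%:R <= N (rho n.+2).
  rewrite (le_trans (FN n))// covering_number_anti ?radius_gt0//.
  by rewrite radiusS ler_pdivrMr// ler_peMr ?ler1n// ltW// radius_gt0.
have h2 := FN n.+1.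
apply: (@le_trans _ _ ((size (level_points F n))%:R ^+ 2)).
  rewrite -natrX ler_nat size_filter (leq_trans (count_size _ _))//.
  by rewrite size_allpairs expnS expn1.
rewrite ler_sqr ?nnegrE ?ler0n//.
  by rewrite size_cat natrD mulr_natl mulr2n lerD.
by rewrite mulr_ge0// (le_trans _ h2).
Qed.

(* Each pair is charged to one level at which it occurs. *)
Lemma esumr_levels (f : J -> R) (v : nat -> R) (M : R) : (forall i, 0 <= f i) ->
  (forall n, 0 <= v n) ->
  (forall n (i : J), val i \in level_pairs F C n -> f i <= v n) ->
  (forall m, \sum_(n < m) (size (level_pairs F C n))%:R * v n <= M) ->
  (esumr f <= M%:E)%E.
Proof.
move=> f0 v0 fv vM; apply: esumr_le => A fA; rewrite fsbig_finite//=.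
set sA := finmap.enum_fset (fset_set A).
have usA : uniq sA by exact: finmap.fset_uniq.
have /choice[lev levP] : forall i : J, exists n, val i \in level_pairs F C n.
  by move=> i; have [] := set_valP i.
(* The largest level used by [A], so that [inord] below is faithful. *)
pose m := \max_(i <- sA) lev i.
apply: le_trans (vM m.+1).
rewrite big_seq (partition_big (fun i => inord (lev i) : 'I_m.+1) xpredT)//=.
apply: ler_sum => j _.
rewrite -big_filter; set sj := [seq _ <- _ | _] => /=.
apply: (@le_trans _ _ (\sum_(i <- sj) v j)).
  rewrite big_seq [leRHS]big_seq; apply: ler_sum => i.
  rewrite mem_filter => /andP[/andP[iA /eqP ij] _]; apply: fv.
  have -> : nat_of_ord j = lev i; last exact: levP.
  by rewrite -ij inordK// ltnS leq_bigmax_seq.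
rewrite sumr_const_size ler_wpM2r// ler_nat -(size_map val).
apply: uniq_leq_size; first by rewrite map_inj_uniq ?filter_uniq//; exact: val_inj.
move=> p /mapP[i + ->]; rewrite mem_filter => /andP[/andP[iA /eqP ij] _].
have -> : nat_of_ord j = lev i; last exact: levP.
by rewrite -ij inordK// ltnS leq_bigmax_seq.
Qed.

Lemma net_pairs_p_summable (s : R) : (2%:E * upper_minkowski_dim T < s%:E)%E ->
  p_summable (pairs_triple J) s.
Proof.
move=> dims.
(* Room is left between the dimension and s/2: the covering numbers are eventually at most
   rho^(-s'), and their squares still lose against rho^s. *)
have [s' ds' s's] : exists2 s' : R, (upper_minkowski_dim T < s'%:E)%E & 2 * s' < s.
  case: (upper_minkowski_dim T) dims => [d| |].
  - rewrite -EFinM lte_fin => ds; exists ((d + s / 2) / 2); first by rewrite lte_fin; lra.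
    by lra.
  - by rewrite mulry gtr0_sg// mul1e.
  - by move=> _; exists (s / 2 - 1); [exact: ltNyr|lra].
have [r0 r00 Nr] := upper_minkowski_dim_lt T_neq0 T_compact ds'.
have [n0 n0r] := radius_lt r00.
have rN n : (n0 <= n)%N -> N (rho n) <= rho n `^ (- s').
  move=> n0n; apply: Nr; first exact: radius_gt0.
  by apply: le_lt_trans n0r; rewrite /radius ler_wiXn2l ?invr_ge0 ?invf_le1 ?ler1n.
(* A negative s' would push a covering number below 1. Nonnegativity of s' makes [s] positive. *)
have s'0 : 0 <= s'.
  have h : 1 <= rho n0.+1 `^ (- s').
    by apply: le_trans (rN _ (leqnSn _)); rewrite covering_number_ge1 ?radius_gt0.
  rewrite leNgt; apply/negP => s'0; move: h; rewrite leNgt => /negP; apply.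
  rewrite [ltRHS](_ : 1 = 1 `^ (- s')); last by rewrite powR1.
  rewrite gt0_ltr_powR ?nnegrE ?oppr_gt0// ?(ltW (radius_gt0 _ _))//.
  by rewrite radiusS ltr_pdivrMr// mul1r (le_lt_trans (radius_le1 _ _))// ltr1n.
have s0 : 0 < s by apply: le_lt_trans s's; rewrite mulr_ge0.
have C0 : 0 <= C by apply: le_trans C_ge2.
pose v n := (C * rho n) `^ s.
have v0 n : 0 <= v n by exact: powR_ge0.
pose q := (2^-1 : R) `^ (s - 2 * s').
have half0 : 0 <= 2^-1 :> R by rewrite invr_ge0.
have q1 : q < 1.
  rewrite [ltRHS](_ : 1 = 1 `^ (s - 2 * s')); last by rewrite powR1.
  by rewrite gt0_ltr_powR ?nnegrE ?subr_gt0// invf_lt1// ltr1n.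
(* The constant gathers the square of the factor 2 from the two nets, the quotient 1/4 between
   [rho n.+2] and [rho n], and the factor C of the lengths. *)
pose A := 4 * (4^-1 `^ (- s')) ^+ 2 * C `^ s.
have A0 : 0 <= A by rewrite !mulr_ge0 ?exprn_ge0 ?powR_ge0.
have [M MP] : exists M, forall m, \sum_(n < m) (size (level_pairs F C n))%:R * v n <= M.
  apply: (@geometric_bound R (fun n => (size (level_pairs F C n))%:R * v n) n0 A q)
    => // [n||n n0n].
  - by rewrite mulr_ge0.
  - exact: powR_ge0.
  have N0 : 0 <= N (rho n.+2).
    by apply: (le_trans ler01); rewrite covering_number_ge1 ?radius_gt0.
  apply: (@le_trans _ _ ((2 * rho n.+2 `^ (- s')) ^+ 2 * v n)).
    rewrite ler_wpM2r// (le_trans (size_level_pairs n))//.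
    rewrite ler_sqr ?nnegrE ?mulr_ge0 ?powR_ge0// ler_wpM2l//.
    by apply: rN; rewrite (leq_trans n0n)// -addn2 leq_addr.
  rewrite /v powRM ?(ltW (radius_gt0 _ _))//.
  have -> : rho n.+2 = 4^-1 * rho n by rewrite !radiusS; field.
  rewrite powRM ?invr_ge0 ?(ltW (radius_gt0 _ _))//.
  have -> : q ^+ n = (rho n `^ (- s')) ^+ 2 * rho n `^ s.
    have r0' : rho n != 0 by rewrite gt_eqF ?radius_gt0.
    rewrite expr2 -!powRD ?r0' ?implybT// /q -powR_mulrn ?powR_ge0//.
    rewrite -powRrM mulrC powRrM powR_mulrn//; congr (_ `^ _); ring.
  by rewrite /A le_eqVlt; apply/orP; left; apply/eqP; ring.
apply: (pairs_p_summable (@net_pairs_neq _ _ F C choose) (ltW s0)).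
apply: (@le_lt_trans _ _ M%:E); last exact: ltry.
apply: (esumr_levels _ v0) => // [i|n [[x y] xyJ] /level_pairsP[_ _ _ xyC]].
  exact: powR_ge0.
by rewrite ge0_ler_powR ?nnegrE ?mdist_ge0 ?mulr_ge0 ?(ltW s0) ?(ltW (radius_gt0 _ _)).
Qed.

End net_pairs_dimension.

(** * Choice of the nets, the orientation and the constant *)

Theorem theorem3p2 (R : realType) (T : metricType R) (delta : R)
    (T_neq0 : [set: T] !=set0) (T_compact : compact [set: T])
    (delta_gt0 : 0 < delta) :
  exists J : set (T * T),
    [/\ countable J,
        unordered_pairs J,
        spectral_triple (pairs_triple J) /\
        (forall s t : T,
          ((mdist s t)%:E <= induced_dist (pairs_triple J) s t)%E /\
          (induced_dist (pairs_triple J) s t <= ((1 + delta) * mdist s t)%:E)%E),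
        (upper_minkowski_dim T < +oo)%E ->
          forall s : R, (2%:E * upper_minkowski_dim T < s%:E)%E ->
            p_summable (pairs_triple J) s &
        forall s : R, 0 < s -> p_summable (pairs_triple J) s ->
          connected [set: T] -> (upper_minkowski_dim T <= s%:E)%E].
Proof.
have /choice[F FP] : forall n, exists F : seq T,
    [/\ uniq F, separated_points (radius R n) F & is_cover (radius R n) F].
  by move=> n; apply: maximal_net => //; exact: radius_gt0.
have F_uniq n : uniq (F n) by case: (FP n).
have F_sep n : separated_points (radius R n) (F n) by case: (FP n).
have F_cover n : is_cover (radius R n) (F n) by case: (FP n).
have [t0 _] := T_neq0.
(* A single choice function on all subsets, with [t0] as default at the empty set; it will orient
   the pairs. *)
have /choice[choose chooseP] : forall A : set T, exists x, A !=set0 -> A x.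
  move=> A; have [[x Ax]|nA] := pselect (A !=set0); first by exists x.
  by exists t0.
(* By compactness the diameter is attained, at [p]. *)
have [p _ pmax] : exists2 p : T * T, p \in [set: T * T] &
    forall q, q \in [set: T * T] -> mdist q.1 q.2 <= mdist p.1 p.2.


  apply: (compact_EVT_max (f := fun p : T * T => mdist p.1 p.2)).
  - by exists (t0, t0).
  - exact: compact_pairT.
  - exact/continuous_subspaceT/mdist_continuous_pair.
pose C := mdist p.1 p.2 + 2 + 16 / delta.
have d0 : 0 < 16 / delta by rewrite divr_gt0.
have C_ge2 : 2 <= C by have := mdist_ge0 p.1 p.2; rewrite /C; lra.
have TC (x y : T) : mdist x y

 + 2 + 16 / delta <= C.
  by rewrite !lerD2r (pmax (x, y))// inE.
exists (net_pairs F C choose); split.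
- exact: net_pairs_countable.
- exact: net_pairs_unordered.
- split=> [|s t].
    apply: pairs_spectral_triple => //; first exact: net_pairs_neq.
    by move=> e e0; exact: net_pairs_finite.
  by split; [exact: net_pairs_dist_ge|exact: net_pairs_dist_le].
- by move=> _ s; exact: net_pairs_p_summable.
- move=> s s0 sJ.
  exact: (net_pairs_dim_le T_neq0 T_compact F_uniq F_sep F_cover C_ge2 chooseP s0 sJ).


Qed.
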